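(* Let $\kappa \ge 3$ be an integer and set $$\beta_\kappa = \sqrt{\kappa(\kappa-1)\log(\kappa-1)} \cdot \min\Bigl\{ \frac{1}{\sqrt{\kappa-2}},\ \frac{\sqrt{2}}{\kappa-2}\Bigr\}.$$ Then for every $\beta \in [0,\beta_\kappa)$, $$\lim_{N\to\infty} F^{\mathrm{bal}}_{N,\beta} = \lim_{N\to\infty} F_{N,\beta} = \log\kappa + \frac{\beta^2(\kappa-1)}{2\kappa^2},$$ where the first limit is taken along $N \in \kappa\mathbb{N}$. In particular, the Potts spin glass model with $\kappa$ colors preserves color symmetry at every inverse temperature $\beta\in[0,\beta_\kappa)$.
   Context: For an integer $N\ge 1$ write $[N]=\{1,\dots,N\}$. Let $\Sigma_\kappa=[\kappa]^N$. Let $(g_{ij})_{i,j\in[N]}$ be i.i.d. standard normal random variables. The Potts spin glass Hamiltonian is $$H_N(\sigma)=\frac{1}{\sqrt N}\sum_{i,j\in[N]} g_{ij}\,\mathbf 1\{\sigma_i=\sigma_j\},\qquad \sigma\in\Sigma_\kappa.$$ The free energy at inverse temperature $\beta\in[0,\infty)$ is $F_{N,\beta}=\frac1N\mathbb{E}\log\sum_{\sigma\in\Sigma_\kappa}\exp(\beta H_N(\sigma))$. A configuration $\sigma\in\Sigma_\kappa$ is balanced if $|\{i\in[N]:\sigma_i=a\}|=N/\kappa$ for every $a\in[\kappa]$; $\Sigma^{\mathrm{bal}}_\kappa$ is the set of balanced configurations. For $N\in\kappa\mathbb N$ the balanced free energy is $F^{\mathrm{bal}}_{N,\beta}=\frac1N\mathbb{E}\log\sum_{\sigma\in\Sigma^{\mathrm{bal}}_\kappa}\exp(\beta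 H_N(\sigma))$. Whenever the balanced constraint is imposed, $N$ is assumed to be a multiple of $\kappa$. The model preserves color symmetry at $\beta\in[0,\infty)$ if $\lim_{N\to\infty}F^{\mathrm{bal}}_{N,\beta}=\lim_{N\to\infty}F_{N,\beta}$. *)

(* Defs.v *)
From HB Require Import structures.
From mathcomp Require Import all_boot all_order all_algebra.
From mathcomp Require Import all_classical all_reals all_analysis.

Set Implicit Arguments.
Unset Strict Implicit.
Unset Printing Implicit Defensive.

Import Order.TTheory GRing.Theory Num.Theory.
Import numFieldNormedType.Exports.

Local Open Scope classical_set_scope.
Local Open Scope ring_scope.

Definition independent_RVs {d : measure_display} {T : measurableType d}
    {R : realType} (P : probability T R) {I : finType}
    (X : I -> {RV P >-> R}) : Prop :=
  forall (J : {set I}) (B : I -> set R),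
    (forall i, measurable (B i)) ->
    P (\bigcap_(i in [set` J]) X i @^-1` B i)
      = (\prod_(i in J) P (X i @^-1` B i))%E.

(* The law is compared on measurable sets only: the values of a measure on
   non-measurable sets carry no information. *)
Definition standard_normal {d : measure_display} {T : measurableType d}
    {R : realType} {P : probability T R} (X : {RV P >-> R}) : Prop :=
  forall A : set R, measurable A -> distribution P X A = normal_prob 0 1 A.

Definition iid_standard_normal {d : measure_display} {T : measurableType d}
    {R : realType} {P : probability T R} (N : nat)
    (g : 'I_N -> 'I_N -> {RV P >-> R}) : Prop :=
  independent_RVs (fun ij : 'I_N * 'I_N => g ij.1 ij.2) /\
  forall i j, standard_normal (g i j).

Definition potts_hamiltonian {T : Type} {R : realType} (kappa N : nat)
    (g : 'I_N -> 'I_N -> T -> R) (sigma : {ffun 'I_N -> 'I_kappa})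
    (w : T) : R :=
  (Num.sqrt N%:R)^-1 *
    \sum_(i < N) \sum_(j < N) g i j w * (sigma i == sigma j)%:R.

Definition balanced (kappa N : nat) : {set {ffun 'I_N -> 'I_kappa}} :=
  [set sigma : {ffun 'I_N -> 'I_kappa} |
    [forall a : 'I_kappa, #|[set i | sigma i == a]| == (N %/ kappa)%N]]%SET.

(* Extended-real valued, like the library's expectation, so that finiteness of
   the expectation is not built in by a junk value. *)
Definition free_energy_on {d : measure_display} {T : measurableType d}
    {R : realType} (P : probability T R) (kappa N : nat)
    (S : {set {ffun 'I_N -> 'I_kappa}})
    (g : 'I_N -> 'I_N -> {RV P >-> R}) (beta : R) : \bar R :=
  ((N%:R^-1)%:E *
   'E_P[fun w => ln (\sum_(sigma in S)
          expR (beta * potts_hamiltonian (fun i j => g i j : T -> R) sigma w))])%E.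

Definition free_energy {d : measure_display} {T : measurableType d}
    {R : realType} (P : probability T R) (kappa N : nat)
    (g : 'I_N -> 'I_N -> {RV P >-> R}) (beta : R) : \bar R :=
  free_energy_on [set: {ffun 'I_N -> 'I_kappa}]%SET g beta.

Definition balanced_free_energy {d : measure_display} {T : measurableType d}
    {R : realType} (P : probability T R) (kappa N : nat)
    (g : 'I_N -> 'I_N -> {RV P >-> R}) (beta : R) : \bar R :=
  free_energy_on (balanced kappa N) g beta.

(* [lim] is a total operator, so existence of both limits is required
   explicitly; the balanced limit runs over the multiples N = kappa * m. *)
Definition preserves_color_symmetry {d : measure_display}
    {T : measurableType d} {R : realType} (P : probability T R) (kappa : nat)
    (g : forall N : nat, 'I_N -> 'I_N -> {RV P >-> R}) (beta : R) : Prop :=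
  let Fbal := fun m : nat =>
    balanced_free_energy kappa (g (kappa * m)%N) beta in
  let F := fun N : nat => free_energy kappa (g N) beta in
  [/\ cvg (Fbal @ \oo), cvg (F @ \oo) & lim (Fbal @ \oo) = lim (F @ \oo)].

Definition beta_threshold (R : realType) (kappa : nat) : R :=
  Num.sqrt (kappa%:R * (kappa%:R - 1) * ln (kappa%:R - 1)) *
  Num.min (1 / Num.sqrt (kappa%:R - 2)) (Num.sqrt 2 / (kappa%:R - 2)).

(* Main.v *)
Require Import Defs.
From HB Require Import structures.
From mathcomp Require Import all_boot all_order all_algebra.
From mathcomp Require Import all_classical all_reals all_analysis measurable_realfun.
From mathcomp Require Import ring lra.
Import Order.TTheory GRing.Theory Num.Theory.
Import numFieldNormedType.Exports.
Local Open Scope classical_set_scope.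
Local Open Scope ring_scope.

Set Implicit Arguments.
Unset Strict Implicit.
Unset Printing Implicit Defensive.

(** Why the theorem is true.

    Replacing the indicator of equal colours by the indicator minus 1/kappa
    changes every energy by the same centred Gaussian variable, so it leaves
    both free energies unchanged.  After this centring a balanced
    configuration has energy variance N (kappa-1)/kappa^2, and the claimed
    limit is that of (1/N) log E Z for the balanced partition function Z.

    Upper bound.  By Jensen, the free energy is at most 1/N times the logarithm
    of the mean of the partition function of all configurations.  If n_a is the
    number of sites of colour a, the variance of the energy exceeds the balanced one
    by (1 - 2/kappa) (sum n_a^2/N - N/kappa).  This excess is compensated by
    the loss of entropy, through [entropy_chi2]: with
    C = (kappa-1) log(kappa-1)/(kappa-2), the relative entropy of a
    distribution on kappa points with respect to the uniform one is at least C
    times (sum p_a^2 - 1/kappa).  The sum over configurations of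
    exp(- N times the Shannon entropy of the type) is polynomial in N ([types_bound]: each type contributes
    at most the total mass 1 of a product measure), so it disappears in the
    limit.  This uses beta^2 (1 - 2/kappa) <= 2 C, the second term of the
    minimum.

    Lower bound.  For two balanced configurations with joint colour counts
    n_ab, the covariance of the energies is sum n_ab^2/N - N/kappa^2.
    Applying the same inequality to each row of the matrix of counts shows
    that E Z^2 is at most a polynomial in N times (E Z)^2
    ([second_moment_le]).  This uses beta^2 <= kappa C, the first term of the
    minimum.  A polynomial second moment ratio is enough because log Z is
    exponentially concentrated: it is Lipschitz with constant beta/sqrt N in
    each of the N^2 Gaussian variables, so
    log E exp (lam log Z) <= lam E log Z + lam^2 beta^2 N
    ([gauss_tuple_concentration], proved by symmetrising one coordinate at a
    time).  A truncation at the level 2 M E Z, where M bounds the second moment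
    ratio, gives E Z^lam >= (E Z)^lam/(4 M), and comparing the two estimates
    bounds E log Z from below by log E Z up to lam beta^2 N + O(log N)/lam
    ([second_moment_bound]).  The choice lam = N^(-1/4) makes the error o(N).

    The free energy of all configurations is at least that of the
    configurations whose first kappa floor(N/kappa) sites are balanced.  The
    same second moment computation applies to them for every N, since the
    fewer than kappa remaining sites change overlaps by O(N). *)

(** * Logarithmic inequalities *)

Section derivative_rules.
Variable R : realType.
Implicit Types (x y z t s : R).

Lemma le_of_derive_ge0 (f df : R -> R) a b : a <= b ->
  (forall x, a <= x <= b -> is_derive x 1 f (df x)) ->
  (forall x, a <= x <= b -> 0 <= df x) -> f a <= f b.
Proof.
move=> ab fd df0; rewrite -subr_ge0.
have fd' x : x \in `]a, b[ -> is_derive x 1 f (df x).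
  by rewrite in_itv/= => /andP[ax xb]; apply: fd; rewrite !ltW.
have [|c] := MVT_segment ab fd'.
  apply: derivable_within_continuous => x; rewrite in_itv/= => xab.
  by have [] := fd x xab.
by rewrite in_itv/= => cab ->; rewrite mulr_ge0 ?df0// subr_ge0.
Qed.

Lemma deriveC_fun (c x : R) : is_derive x 1 (fun _ : R => c) 0.
Proof. exact: is_derive_cst. Qed.

Lemma derive_id_fun (x : R) : is_derive x 1 (fun y : R => y) 1.
Proof. exact: is_derive_id. Qed.

Lemma deriveD_fun (f g : R -> R) (x a b : R) : is_derive x 1 f a -> is_derive x 1 g b ->
  is_derive x 1 (fun y => f y + g y) (a + b).
Proof. exact: is_deriveD. Qed.

Lemma deriveN_fun (f : R -> R) (x a : R) : is_derive x 1 f a ->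
  is_derive x 1 (fun y => - f y) (- a).
Proof. exact: is_deriveN. Qed.

Lemma deriveM_fun (f g : R -> R) (x a b : R) : is_derive x 1 f a -> is_derive x 1 g b ->
  is_derive x 1 (fun y => f y * g y) (a * g x + f x * b).
Proof.
move=> fa gb; apply: (is_derive_eq (is_deriveM fa gb)).
by rewrite /GRing.scale /= addrC mulrC.
Qed.

Lemma deriveX2_fun (f : R -> R) (x a : R) : is_derive x 1 f a ->
  is_derive x 1 (fun y => f y ^+ 2) (2 * f x * a).
Proof.
move=> fa; apply: (is_derive_eq (deriveM_fun fa fa)); ring.
Qed.

Lemma deriveV_fun (f : R -> R) (x a : R) : f x != 0 -> is_derive x 1 f a ->
  is_derive x 1 (fun y => (f y)^-1) (- a / f x ^+ 2).
Proof.
move=> f0 fa; apply: (is_derive_eq (is_deriveV f0 fa)).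
by rewrite /GRing.scale /= mulNr mulNr mulrC.
Qed.

Lemma derive_ln_fun (f : R -> R) (x a : R) : 0 < f x -> is_derive x 1 f a ->
  is_derive x 1 (fun y => ln (f y)) (a / f x).
Proof.
move=> f0 fa; apply: (is_derive_eq (is_derive1_comp (is_derive1_ln f0) fa)).
by rewrite mulrC.
Qed.

End derivative_rules.

Ltac derive_step := first
  [ exact: deriveC_fun | exact: derive_id_fun | apply: deriveD_fun
  | apply: deriveN_fun | apply: deriveX2_fun | apply: deriveM_fun
  | apply: deriveV_fun | apply: derive_ln_fun ].

Section log_inequalities.
Variable R : realType.
Implicit Types (s t : R).

(** Both sides vanish at 1, and the derivative of the difference is the square
    (1 - 1/x)^2/2. *)
Lemma ln_le_half t : 1 <= t -> ln t <= (t - t^-1) / 2.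
Proof.
move=> t1.
have := @le_of_derive_ge0 R (fun x : R => (x - x^-1) / 2 - ln x)
  (fun x => (1 - x^-1) ^+ 2 / 2) 1 t t1.
rewrite ln1 invr1 subrr mul0r subr0 subr_ge0; apply.
- move=> x /andP[x1 _].
  have x0 : 0 < x by lra.
  have xn0 : x != 0 by rewrite gt_eqF.
  apply: is_derive_eq; first by repeat derive_step.
  rewrite /= /GRing.scale /=; field; lra.
- by move=> x _; rewrite divr_ge0 ?sqr_ge0.
Qed.

Lemma ln_ge_half t : 0 < t <= 1 -> (t - t^-1) / 2 <= ln t.
Proof.
move=> /andP[t0 t1]; have := @ln_le_half t^-1.
rewrite invf_ge1// => /(_ t1); rewrite lnV ?posrE// invrK; lra.
Qed.

(** All Taylor coefficients of - ln at 1 in powers of 1 - v are nonnegative. *)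
Lemma opp_ln_ge_taylor2 (v : R) : 0 < v <= 1 -> (1 - v) + (1 - v) ^+ 2 / 2 <= - ln v.
Proof.
move=> /andP[v0 v1].
have := @le_of_derive_ge0 R (fun x : R => ln x + (1 - x) + (1 - x) ^+ 2 / 2)
  (fun x => (1 - x) * (x^-1 - 1)) v 1 v1.
rewrite ln1 subrr expr0n /= mul0r !addr0.
move=> H; suff : ln v + (1 - v) + (1 - v) ^+ 2 / 2 <= 0 by lra.
apply: H.
- move=> x /andP[vx _].
  have x0 : 0 < x by lra.
  apply: is_derive_eq; first by repeat derive_step.
  rewrite /= /GRing.scale /=; field; lra.
- move=> x /andP[vx x1]; rewrite mulr_ge0 ?subr_ge0// invf_ge1//; lra.
Qed.

(** With t = (1+y)/(1-y) the ratio is 2 artanh(y)/y.  That this ratio increases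
    is what makes the binary entropy convex as a function of y^2; the sign of
    its derivative is [ln_le_half]. *)
Lemma ln_ratio_ndecr t s : 1 < t -> t <= s ->
  ln t * (t + 1) / (t - 1) <= ln s * (s + 1) / (s - 1).
Proof.
move=> t1 ts.
apply: (@le_of_derive_ge0 R (fun x : R => ln x * (x + 1) / (x - 1))
  (fun x => ((x - x^-1) - 2 * ln x) / (x - 1) ^+ 2) t s ts).
- move=> x /andP[tx _].
  have x0 : 0 < x by lra.
  have x1 : x - 1 != 0 by rewrite gt_eqF//; lra.
  apply: is_derive_eq; first by repeat derive_step.
  rewrite /= /GRing.scale /=; field; lra.
- move=> x /andP[tx _]; rewrite divr_ge0 ?sqr_ge0//.
  by have := @ln_le_half x; lra.
Qed.

End log_inequalities.

(** * Relative entropy against the chi-square distance *)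

Ltac nonzero := repeat (apply/andP; split); first [lra | rewrite gt_eqF; lra].

Section entropy_variance.
Variable R : realType.
Implicit Types (c k q v x y z : R).

(** For a density x of mean 1 with respect to the uniform distribution, the
    average of [dev c] is the relative entropy minus c times the variance.
    The affine part makes both the function and its derivative vanish at 1. *)
Definition dev c x := x * ln x - x + 1 - c * (x - 1) ^+ 2.

Lemma dev1 c : dev c 1 = 0.
Proof. by rewrite /dev ln1; ring. Qed.

(** The function [dev c] is convex on [0, 1] for c <= 1/2; in tangent form, which
    allows q = 0, where its derivative is infinite. *)
Lemma dev_tangent c z q : c <= 2^-1 -> 0 < z <= 1 -> 0 <= q <= 1 ->
  dev c z + (ln z - 2 * c * (z - 1)) * (q - z) <= dev c q.
Proof.
move=> c2 /andP[z0 z1] /andP[q0 q1].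
suff : q - z + (q - z) ^+ 2 / 2 <= q * ln q - q * ln z.
  have := sqr_ge0 (q - z); rewrite /dev; nra.
have [->|qn0] := eqVneq q 0; first by rewrite !mul0r; nra.
have {qn0}q0 : 0 < q by rewrite lt0r qn0.
have [qz|zq] := lerP q z.
  have t01 : 0 < q / z <= 1 by rewrite divr_gt0//= ler_pdivrMr// mul1r.
  have := ln_ge_half t01; rewrite ln_div ?posrE// invf_div => H.
  have : q * ((q / z - z / q) / 2) <= q * (ln q - ln z) by rewrite ler_wpM2l// ltW.
  have -> : q * ((q / z - z / q) / 2) = (q ^+ 2 - z ^+ 2) / 2 / z.
    by field; rewrite !gt_eqF.
  have : (q - z + (q - z) ^+ 2 / 2) <= (q ^+ 2 - z ^+ 2) / 2 / z.
    rewrite ler_pdivlMr//; have := sqr_ge0 (q - z); nra.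
  lra.
have v01 : 0 < z / q <= 1 by rewrite divr_gt0//= ler_pdivrMr// mul1r ltW.
have := opp_ln_ge_taylor2 v01; rewrite ln_div ?posrE// => H.
have : q * ((1 - z / q) + (1 - z / q) ^+ 2 / 2) <= q * (ln q - ln z).
  by rewrite ler_wpM2l ?(ltW q0)//; lra.
have -> : q * ((1 - z / q) + (1 - z / q) ^+ 2 / 2) = (q - z) + (q - z) ^+ 2 / 2 / q.
  by field; rewrite gt_eqF.
have : (q - z) ^+ 2 / 2 <= (q - z) ^+ 2 / 2 / q.
  by rewrite ler_pdivlMr// ler_piMr// divr_ge0// sqr_ge0.
lra.
Qed.

(** The best constant between relative entropy and chi-square distance on k
    points; k times it is half the critical inverse temperature of the
    Curie-Weiss-Potts model. *)
Definition potts_const k := (k - 1) * ln (k - 1) / (k * (k - 2)).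

Lemma potts_const_le_half k : 2 < k -> potts_const k <= 2^-1.
Proof.
move=> k2; rewrite /potts_const ler_pdivrMr; last by rewrite mulr_gt0//; lra.
have := @ln_le_half _ (k - 1); have : 1 <= k - 1 by lra.
move=> k1 /(_ k1) H.
have : (k - 1) * ln (k - 1) <= (k - 1) * ((k - 1 - (k - 1)^-1) / 2).
  by rewrite ler_wpM2l//; lra.
have -> : (k - 1) * ((k - 1 - (k - 1)^-1) / 2) = 2^-1 * (k * (k - 2)).
  by field; nonzero.
by [].
Qed.

(** One k-th of the sum of [dev (potts_const k)] over the density taking the value
    k x at one point and a common value at the k - 1 other points. *)
Definition binary_gap k x := x * ln x + (1 - x) * ln (1 - x) + ln k
  - (1 - x) * ln (k - 1) - k * ln (k - 1) / (k - 2) * (x - k^-1) ^+ 2.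

(** The constant [potts_const k] is exactly the one for which the gap is symmetric
    about 1/2.  Hence its zero at the uniform point 1/k is matched by a zero at
    (k-1)/k, and the inequality below is sharp at both points. *)
Lemma binary_gap_sym k x : 2 < k -> binary_gap k (1 - x) = binary_gap k x.
Proof.
move=> k2; rewrite /binary_gap (_ : 1 - (1 - x) = x); last by ring.
by field; nonzero.
Qed.

Lemma binary_gap_derive k x : 2 < k -> 0 < x < 1 ->
  is_derive x 1 (binary_gap k)
    (ln x - ln (1 - x) - k * ln (k - 1) / (k - 2) * (2 * x - 1)).
Proof.
move=> k2 /andP[x0 x1]; have x1' : 0 < 1 - x by lra.
apply: is_derive_eq; first by repeat derive_step.
by rewrite /= /GRing.scale /=; field; nonzero.
Qed.

Lemma binary_gap0 k : 2 < k -> binary_gap k ((k - 1) / k) = 0.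
Proof.
move=> k2; rewrite /binary_gap.
have -> : 1 - (k - 1) / k = k^-1 by field; nonzero.
rewrite ln_div ?posrE; [|lra|lra]; rewrite lnV ?posrE; last lra.
by field; nonzero.
Qed.

(** By symmetry x >= 1/2.  With y = 2 x - 1 the derivative is y times the
    difference of 2 artanh(y)/y and its value at x = (k-1)/k, so by
    [ln_ratio_ndecr] the gap decreases up to (k-1)/k, where it vanishes, and
    increases afterwards. *)
Lemma binary_gap_ge0 k x : 2 < k -> 0 < x < 1 -> 0 <= binary_gap k x.
Proof.
move=> k2; wlog x2 : x / 2^-1 <= x => [H|] x01.
  have [x2|x2] := lerP (2^-1) x; first exact: H.
  by rewrite -binary_gap_sym//; apply: H; lra.
have k0 : 0 < k by lra.
pose X0 := (k - 1) / k.
have X0k : X0 * k = k - 1 by rewrite /X0 divfK// gt_eqF.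
have X01 : 0 < X0 < 1.
  by rewrite divr_gt0//=; [rewrite ltr_pdivrMr//; lra|lra].
have X02 : 2^-1 < X0 by rewrite ltr_pdivlMr//; lra.
have ratio y : 2^-1 < y < 1 ->
    ln (y / (1 - y)) * (y / (1 - y) + 1) / (y / (1 - y) - 1) =
    (ln y - ln (1 - y)) / (2 * y - 1).
  move=> /andP[y1 y2]; rewrite ln_div ?posrE; [|lra|lra].
  by field; nonzero.
have tk : X0 / (1 - X0) = k - 1.
  by rewrite /X0; field; nonzero.
have slope (y : R) : 2^-1 < y < 1 -> 1 < y / (1 - y).
  by move=> /andP[y1 y2]; rewrite ltr_pdivlMr; lra.
have slopele (y z : R) : 2^-1 < y -> y <= z -> z < 1 -> y / (1 - y) <= z / (1 - z).
  move=> y1 yz z1; rewrite ler_pdivrMr; last by lra.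
  by rewrite mulrAC ler_pdivlMr; nra.
have cE : k * ln (k - 1) / (k - 2) = (ln X0 - ln (1 - X0)) / (2 * X0 - 1).
  rewrite -ratio ?X02//=; last by case/andP: X01.
  by rewrite tk; field; nonzero.
have dle y z : 2^-1 < y -> y <= z -> z < 1 ->
   (ln y - ln (1 - y)) / (2 * y - 1) <= (ln z - ln (1 - z)) / (2 * z - 1).
  move=> y1 yz z1; rewrite -!ratio; try lra.
  by apply: ln_ratio_ndecr; [apply: slope; lra|exact: slopele].
rewrite -(binary_gap0 k2) -/X0.
pose D y := ln y - ln (1 - y) - k * ln (k - 1) / (k - 2) * (2 * y - 1).
have [xX|Xx] := lerP x X0.
  suff : - binary_gap k x <= - binary_gap k X0 by lra.
  apply: (@le_of_derive_ge0 _ (fun y => - binary_gap k y) (fun y => - D y) _ _ xX) => [y yI|y /andP[y1 y2]].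
    by apply: deriveN_fun; apply: binary_gap_derive => //; lra.
  rewrite /D; have [->|yn] := eqVneq y 2^-1.
    have -> : 1 - 2^-1 = 2^-1 :> R by field.
    by rewrite subrr divff// subrr mulr0 subrr oppr0.
  have y3 : 2^-1 < y by rewrite lt_neqAle eq_sym yn (le_trans x2).
  have := dle y X0 y3 y2; rewrite -cE ler_pdivrMr; last by lra.
  by lra.
apply: (@le_of_derive_ge0 _ (binary_gap k) D _ _ (ltW Xx)) => [y yI|y /andP[y1 y2]].
  by apply: binary_gap_derive => //; lra.
rewrite /D; have := dle X0 y X02 y1; rewrite -cE ler_pdivlMr; last by lra.
by lra.
Qed.

(** At x = 1 the derivative is infinite, and the gap is bounded directly. *)
Lemma binary_gap_at1 k : 2 < k -> 0 <= binary_gap k 1.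
Proof.
move=> k2; rewrite /binary_gap ln1 subrr !mul0r.
have k0 : 0 < k by lra.
have -> : k * ln (k - 1) / (k - 2) * (1 - k^-1) ^+ 2 =
    ln (k - 1) + ln (k - 1) / (k * (k - 2)) by field; nonzero.
have l1 : ln (k - 1) <= k - 2.
  by have := @le_ln1Dx _ (k - 2); rewrite (_ : 1 + (k - 2) = k - 1); [apply; lra|ring].
have : ln (k - 1) / (k * (k - 2)) <= k^-1.
  rewrite ler_pdivrMr; last by rewrite mulr_gt0; lra.
  by rewrite mulrA mulVf ?gt_eqF// mul1r.
have := @opp_ln_ge_taylor2 _ ((k - 1) / k).
have vE : 1 - (k - 1) / k = k^-1 by field; nonzero.
rewrite vE ln_div ?posrE; [|lra|lra].
have vI : 0 < (k - 1) / k <= 1.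
  by rewrite divr_gt0//=; [rewrite ler_pdivrMr//; lra|lra].
move=> /(_ vI); have := sqr_ge0 (k^-1); lra.
Qed.

Lemma dev_pair k x : 2 < k -> 1 <= x <= k ->
  0 <= dev (potts_const k) x + (k - 1) * dev (potts_const k) ((k - x) / (k - 1)).
Proof.
move=> k2 /andP[x1 xk].
have k0 : 0 < k by lra.
have -> : dev (potts_const k) x + (k - 1) * dev (potts_const k) ((k - x) / (k - 1))
    = k * binary_gap k (x / k).
  have lx : ln x = ln k + ln (x / k).
    by rewrite ln_div ?posrE; lra.
  have [->|xn] := eqVneq x k.
    rewrite subrr mul0r divff ?gt_eqF// /dev /binary_gap /potts_const ln1 subrr !mul0r.
    by field; nonzero.
  have xk' : x < k by rewrite lt_neqAle xn.
  have lw : ln ((k - x) / (k - 1)) = ln k - ln (k - 1) + ln (1 - x / k).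
    have -> : 1 - x / k = (k - x) / k by field; nonzero.
    by rewrite !ln_div ?posrE; lra.
  rewrite /dev /binary_gap /potts_const lw lx.
  by field; nonzero.
apply: mulr_ge0; first exact: ltW.
have [->|xn] := eqVneq x k; first by rewrite divff ?gt_eqF// binary_gap_at1.
apply: binary_gap_ge0 => //.
rewrite divr_gt0//=; last by lra.
by rewrite ltr_pdivrMr// mul1r lt_neqAle xn.
Qed.

End entropy_variance.

Section half_convex.
Variable R : realType.
Variables (k : R) (k2 : 2 < k).
Let c := potts_const k.
Let f := dev c.

Let c2 : c <= 2^-1. Proof. exact: potts_const_le_half. Qed.

(** Slopes of chords through the zero of the convex function [f] at 1 are
    monotone. *)
Lemma dev_chord (u v : R) : 0 <= v <= u -> 0 < u <= 1 -> f (1 - v) <= v / u * f (1 - u).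
Proof.
move=> /andP[v0 vu] /andP[u0 u1].
have [v1|vn1] := eqVneq v 1.
  have uE : u = 1 by lra.
  by rewrite v1 uE divr1 mul1r.
have {vn1}v1 : v < 1 by rewrite lt_neqAle vn1; lra.
set w := v / u; have wu : w * u = v by rewrite /w divfK// gt_eqF.
have w0 : 0 <= w by rewrite divr_ge0// ltW.
have w1 : w <= 1 by rewrite ler_pdivrMr// mul1r.
have p01 : 0 < 1 - v <= 1 by lra.
have := @dev_tangent _ c (1 - v) (1 - u) c2 p01; rewrite -/f => /(_ _) H1.
have := @dev_tangent _ c (1 - v) 1 c2 p01; rewrite dev1 -/f => /(_ _) H2.
have {}H1 := H1 ltac:(lra); have {}H2 := H2 ltac:(lra).
move: H1 H2; set D := ln _ - _; set p := f (1 - v); set q := f (1 - u) => H1 H2.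
have : w * (p + D * (1 - u - (1 - v))) + (1 - w) * (p + D * (1 - (1 - v))) <= w * q + (1 - w) * 0.
  by apply: lerD; apply: ler_wpM2l => //; lra.
suff -> : w * (p + D * (1 - u - (1 - v))) + (1 - w) * (p + D * (1 - (1 - v))) = p by lra.
by rewrite -wu; ring.
Qed.

(** [dev_pair] bounds the contribution of one value above 1 from below by k - 1
    values below 1, and [dev_chord] transfers this to the point 1 - u. *)
Lemma dev_big_ge (x u : R) : 1 < x <= k -> x - 1 <= (k - 1) * u -> 0 < u <= 1 ->
  - ((x - 1) / u) * f (1 - u) <= f x.
Proof.
move=> /andP[x1 xk] xu u01.
have /andP[u0 u1] := u01.
have xI : 1 <= x <= k by rewrite xk ltW.
have := dev_pair k2 xI; rewrite -/c -/f.
set v := (x - 1) / (k - 1); have vk : v * (k - 1) = x - 1.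
  by rewrite /v divfK// gt_eqF//; lra.
have -> : (k - x) / (k - 1) = 1 - v by rewrite /v; field; nonzero.
have vI : 0 <= v <= u.
  by rewrite /v divr_ge0/=; [rewrite ler_pdivrMr; lra|lra|lra].
have := dev_chord vI u01.
move=> H1 H2.
have : (k - 1) * f (1 - v) <= (k - 1) * (v / u * f (1 - u)).
  by apply: ler_wpM2l => //; lra.
have -> : (k - 1) * (v / u * f (1 - u)) = (x - 1) / u * f (1 - u).
  by rewrite -vk; ring.
lra.
Qed.

(** A half-convex function argument.  On [0, 1] the function is convex, so by
    Jensen the n values at most 1 may be replaced by their mean 1 - u.  Each
    value x above 1 contributes at least - (x-1)/u times f (1 - u), by
    [dev_big_ge].  The deviations above and below 1 have the same total n u, so
    the two contributions cancel. *)
Lemma sum_dev_ge0 (A : finType) (x : A -> R) : k = #|A|%:R ->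
  (forall a, 0 <= x a) -> \sum_a x a = k -> 0 <= \sum_a f (x a).
Proof.
move=> kA x0 xk.
pose sm := [pred a | x a <= 1].
pose n := \sum_(a | sm a) (1 : R); pose nb := \sum_(a | ~~ sm a) (1 : R).
have nbn : n + nb = k.
  by rewrite kA -sum1_card natr_sum [RHS](bigID sm).
pose E := \sum_(a | sm a) (1 - x a).
have EB : \sum_(a | ~~ sm a) (x a - 1) = E.
  rewrite /E !sumrB -/n -/nb.
  by move: xk; rewrite (bigID sm)/=; lra.
have [big0|[b bb]] : (forall a, sm a) \/ (exists b, ~~ sm b).
  have [/existsP H|/existsPn H] := boolP [exists b, ~~ sm b]; first by right.
  by left => a; have := H a; rewrite negbK.
  have x1 a : x a = 1.
    have E0 : E = 0 by rewrite -EB big_pred0// => i; rewrite big0.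
    have := @psumr_eq0P _ _ sm (fun a => 1 - x a).
    move=> H; have := H _ E0 a (big0 a).
    by move=> H'; apply/eqP; rewrite eq_sym -subr_eq0; apply/eqP/H' => i; rewrite /sm/= subr_ge0.
  by rewrite big1// => a _; rewrite x1 /f dev1.
have nb1 : 1 <= nb.
  by rewrite /nb (bigD1 b)//= lerDl sumr_ge0.
have En : E <= n by rewrite /E /n; apply: ler_sum => a _; rewrite lerBlDl lerDr.
have Eb : x b - 1 <= E.
  rewrite -EB (bigD1 b)//= lerDl; apply: sumr_ge0 => a /andP[+ _].
  by rewrite /sm/= -ltNge; lra.
have E0 : 0 < E by move: bb; rewrite /sm/= -ltNge; lra.
have n0 : 0 < n by lra.
pose u := E / n; have un : u * n = E by rewrite /u divfK// gt_eqF.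
have u01 : 0 < u <= 1 by rewrite divr_gt0//= ler_pdivrMr// mul1r.
have /andP[u0 u1] := u01.
have small : n * f (1 - u) <= \sum_(a | sm a) f (x a).
  rewrite /n mulr_suml; under eq_bigr do rewrite mul1r.
  (* At mean 0 the tangent does not exist, but all the values are then 0. *)
  have [uE|un1] := eqVneq u 1.
    have x0' a : sm a -> x a = 0.
      have : \sum_(a | sm a) x a = 0.
        by move: un; rewrite uE mul1r /E sumrB -/n; lra.
      by move=> H; apply: (psumr_eq0P _ H) => i _; exact: x0.
    by rewrite uE; apply: ler_sum => a /x0' ->; rewrite subrr.
  have z01 : 0 < 1 - u <= 1 by rewrite subr_gt0 lt_neqAle un1 u1/=; lra.
  pose D := ln (1 - u) - 2 * c * ((1 - u) - 1).
  have -> : \sum_(a | sm a) f (1 - u) =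
      \sum_(a | sm a) (f (1 - u) + D * (x a - (1 - u))).
    rewrite [RHS]big_split/= -mulr_sumr.
    have -> : \sum_(a | sm a) (x a - (1 - u)) = 0.
      have -> : \sum_(a | sm a) (x a - (1 - u)) = u * n - E.
        rewrite /E /n mulr_sumr -sumrB; apply: eq_bigr => a _; ring.
      by rewrite un subrr.
    by rewrite mulr0 addr0.
  apply: ler_sum => a sa; apply: dev_tangent => //.
  by rewrite x0.
have xle a : x a <= k.
  by rewrite -xk (bigD1 a)//= lerDl sumr_ge0.
have big : \sum_(a | ~~ sm a) - ((x a - 1) / u) * f (1 - u) <= \sum_(a | ~~ sm a) f (x a).
  apply: ler_sum => a sa; apply: dev_big_ge => //.
    by rewrite xle andbT; move: sa; rewrite /sm/= -ltNge.
  have : x a - 1 <= E.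
    rewrite -EB (bigD1 a)//= lerDl; apply: sumr_ge0 => i /andP[+ _].
    by rewrite /sm/= -ltNge; lra.
  rewrite -un => H; apply: (le_trans H); rewrite mulrC ler_wpM2r ?(ltW u0)//.
  lra.
rewrite (bigID sm)/=.
suff : n * f (1 - u) + \sum_(a | ~~ sm a) - ((x a - 1) / u) * f (1 - u) = 0 by lra.
rewrite -mulr_suml sumrN -mulr_suml EB -un.
by rewrite mulrAC divff ?gt_eqF// mul1r; ring.
Qed.

End half_convex.

(** The inequality [sum_dev_ge0] for the empirical distribution n_a/M, multiplied
    by M. *)
Lemma entropy_chi2 (R : realType) (A : finType) (n : A -> nat) (M : nat) (k : R) :
  2 < k -> k = #|A|%:R -> (\sum_a n a)%N = M ->
  k * potts_const k * (\sum_a (n a)%:R ^+ 2 / M%:R - M%:R / k) <=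
  \sum_a (n a)%:R * ln (k * (n a)%:R / M%:R).
Proof.
move=> k2 kA nM; set c := potts_const k.
have [M0|M0] := posnP M.
  rewrite M0 invr0; rewrite !big1 ?mul0r ?subrr ?mulr0// => a _; last by rewrite mulr0.
  suff -> : n a = 0%N by rewrite mul0r.
  by move: nM; rewrite M0 => /eqP; rewrite sum_nat_eq0 => /forallP/(_ a)/eqP.
have Mp : 0 < M%:R :> R by rewrite ltr0n.
have nMr : \sum_a (n a)%:R = M%:R :> R by rewrite -nM natr_sum.
move: Mp nMr; move: M%:R => m Mp nMr.
pose x a : R := k * (n a)%:R / m.
have xk : \sum_a x a = k.
  rewrite /x -mulr_suml -mulr_sumr nMr mulfK// gt_eqF//.
have := sum_dev_ge0 k2 kA (x := x).
have x0 a : 0 <= x a by rewrite divr_ge0 ?(ltW Mp) ?mulr_ge0//; lra.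
move=> /(_ x0 xk); rewrite -/c.
have -> : \sum_a dev c (x a) =
    k / m * (\sum_a (n a)%:R * ln (k * (n a)%:R / m)
     - (k * c) * (\sum_a (n a)%:R ^+ 2 / m - m / k)).
  transitivity (\sum_a (k / m * ((n a)%:R * ln (x a)) - x a + 1
     - c * (k / m * k * ((n a)%:R ^+ 2 / m) - 2 * x a + 1))).
    by apply: eq_bigr => a _; rewrite /dev /x; field; nonzero.
  rewrite !(big_split, sumrN) /= -!mulr_sumr !(big_split, sumrN) /= -!mulr_sumr xk.
  rewrite sumr_const -kA.
  by field; nonzero.
by rewrite pmulr_rge0 ?divr_gt0//; lra.
Qed.

(** * Counting configurations by type *)

Section types.
Variables (N : nat) (A : finType).
Implicit Types (J : {set 'I_N}) (s : {ffun 'I_N -> A}) (a b : A).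

Definition cnt J s a : nat := #|[set i in J | s i == a]|.

Lemma cnt_le J s a : (cnt J s a <= #|J|)%N.
Proof. by apply: subset_leq_card; apply/fintype.subsetP => i; rewrite inE => /andP[]. Qed.

Lemma sum_cnt_gen (V : nmodType) J s (F : A -> V) :
  \sum_(i in J) F (s i) = \sum_a F a *+ cnt J s a.
Proof.
rewrite (partition_big s xpredT)//=; apply: eq_bigr => a _.
rewrite /cnt -sum1_card -sumrMnr; apply: eq_big => [i|i]; first by rewrite inE.
by move=> /andP[_ /eqP ->].
Qed.

Lemma sum_cnt J s : (\sum_a cnt J s a)%N = #|J|.
Proof.
rewrite -sum1_card (sum_cnt_gen J s (fun _ => 1%N)).
by apply: eq_bigr => a _; exact: (esym (natn _)).
Qed.

(** The summand is the probability of the restriction of s to J under the product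
    measure with the marginal of its own type.  Grouping by type, each group
    has probability at most 1 on J, the sites outside J are free, and there are at most (|J|+1)^|A| groups. *)
Lemma types_bound (R : realFieldType) J :
  \sum_s \prod_(i in J) ((cnt J s (s i))%:R / #|J|%:R : R) <=
  (#|J|.+1 ^ #|A| * #|A| ^ (N - #|J|))%:R.
Proof.
pose ty s : {ffun A -> 'I_(#|J|.+1)} := [ffun a => inord (cnt J s a)].
have tyE s a : ty s a = cnt J s a :> nat by rewrite ffunE inordK// ltnS cnt_le.
rewrite (partition_big ty xpredT)//=.
have -> : (#|J|.+1 ^ #|A|)%N = #|{ffun A -> 'I_(#|J|.+1)}| by rewrite card_ffun card_ord.
rewrite natrM -[X in X%:R * _]sum1_card natr_sum mulr_suml; apply: ler_sum => t _; rewrite mul1r.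
have [/existsP[s0 /eqP s0t]|/existsPn H] := boolP [exists s, ty s == t]; last first.
  by rewrite big1 ?ler0n// => s st; have := H s; rewrite st.
have sumt : \sum_a (t a)%:R = #|J|%:R :> R.
  rewrite -[RHS](congr1 (fun n => n%:R) (sum_cnt J s0)) natr_sum.
  by apply: eq_bigr => a _; rewrite -s0t tyE.
pose w i a : R := if i \in J then (t a)%:R / #|J|%:R else 1.
apply: (@le_trans _ _ (\sum_(s : {ffun 'I_N -> A}) \prod_i w i (s i))).
  rewrite [leRHS](bigID (fun s => ty s == t))/= -[leLHS]addr0; apply: lerD.
    apply: ler_sum => s /eqP st; rewrite big_mkcond; apply: ler_prod => i _.
    by rewrite /w -st; case: ifP; rewrite ?tyE ?ler01 ?lexx// divr_ge0/=.
  by apply: sumr_ge0 => s _; apply: prodr_ge0 => i _; rewrite /w; case: ifP => // _; rewrite divr_ge0.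
rewrite -(bigA_distr_bigA w) /w.
rewrite (bigID (fun i => i \in J))/= big1 ?mul1r; last first.
  move=> i iJ; rewrite iJ -mulr_suml sumt divff// pnatr_eq0.
  by apply/eqP => J0; move: iJ; rewrite (cards0_eq J0) inE.
rewrite (eq_bigr (fun _ => #|A|%:R)); last first.
  by move=> i /negbTE iJ; under eq_bigr do rewrite iJ; rewrite sumr_const.
rewrite prodr_const natrX (_ : #|_| = (N - #|J|)%N)//.
have <- : #|~: J| = (N - #|J|)%N by rewrite cardsCs finset.setCK card_ord.
by apply: eq_card => i; rewrite !inE.
Qed.

Definition type_class J (t : A -> nat) : {set {ffun 'I_N -> A}} :=
  [set s | [forall a, cnt J s a == t a]]%SET.

Definition set_color j a s : {ffun 'I_N -> A} := [ffun i => if i == j then a else s i].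

Lemma cnt_set_color J j a s : j \notin J -> cnt J (set_color j a s) = cnt J s.
Proof.
move=> jJ; apply/funext => b; apply: eq_card => i; rewrite !inE ffunE.
by case: (i =P j) => // ->; rewrite (negbTE jJ).
Qed.

(** Recolouring a site outside J preserves the type on J. *)
Lemma card_type_class_color J j a t : j \notin J ->
  (#|A| * #|[set s in type_class J t | s j == a]| = #|type_class J t|)%N.
Proof.
move=> jJ.
have le b c : (#|[set s in type_class J t | s j == b]| <=
    #|[set s in type_class J t | s j == c]|)%N.
  rewrite -(@card_in_imset _ _ (set_color j c)); last first.
    move=> s1 s2; rewrite !inE => /andP[_ /eqP s1b] /andP[_ /eqP s2b] /ffunP E.
    apply/ffunP => i; have := E i; rewrite !ffunE; case: (i =P j) => // -> _.
    by rewrite s1b s2b.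
  apply: subset_leq_card; apply/fintype.subsetP => _ /imsetP[s + ->].
  by rewrite !inE ffunE eqxx cnt_set_color// eqxx andbT => /andP[].
rewrite -[RHS]sum1_card (partition_big (fun s => s j) xpredT)//= -(sum_nat_const A).
apply: eq_big => // b _; rewrite sum1_card.
transitivity #|[set s in type_class J t | s j == b]|.
  by apply/eqP; rewrite eqn_leq !le.
by apply: eq_card => s; rewrite !inE [RHS]unfold_in/= inE.
Qed.

Lemma cnt_setD1 J j s a : j \in J -> cnt J s a = (cnt (J :\ j) s a + (s j == a))%N.
Proof.
move=> jJ; rewrite /cnt (cardsD1 j) inE jJ/= addnC; congr (_ + _)%N.
by apply: eq_card => i; rewrite !inE andbA.
Qed.

(** The multinomial formula, by induction on J: remove a site j and sum over its
    colour. *)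
Lemma card_type_class J t : (\sum_a t a)%N = #|J| ->
  (#|type_class J t| * \prod_a (t a)`! * #|A| ^ #|J| = (#|J|)`! * #|A| ^ N)%N.
Proof.
have [n Jn] := ubnP #|J|; elim: n J t Jn => // n IHn J t; rewrite ltnS => Jn tJ.
have [J0|[j jJ]] := set_0Vmem J.
  have t0 a : t a = 0%N.
    by move: tJ; rewrite J0 cards0 => /eqP; rewrite sum_nat_eq0 => /forallP/(_ a)/eqP.
  rewrite J0 cards0 fact0 big1 ?expn0 ?muln1 ?mul1n; last by move=> a _; rewrite t0.
  have <- : #|{ffun 'I_N -> A}| = (#|A| ^ N)%N by rewrite card_ffun card_ord.
  apply: eq_card => s; rewrite !inE.
  apply/forallP => a; rewrite t0 /cnt cards_eq0; apply/eqP/setP => i.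
  by rewrite !inE.
have J1 : #|J| = #|J :\ j|.+1 by rewrite (cardsD1 j) jJ.
pose td a b := (t b - (a == b))%N.
have tdE a b : (0 < t a)%N -> (td a b + (a == b) = t b)%N.
  by rewrite /td; case: (a =P b) => [<- ?|_ _]; [rewrite subnK|rewrite subn0 addn0].
have -> : #|type_class J t| =
    (\sum_(a | 0 < t a) #|[set s in type_class (J :\ j) (td a) | s j == a]|)%N.
  rewrite -sum1_card (partition_big (fun s => s j) (fun a => 0 < t a)%N)/=; last first.
    by move=> s; rewrite inE => /forallP/(_ (s j))/eqP <-; rewrite (cnt_setD1 _ _ jJ) eqxx addn1.
  apply: eq_bigr => a ta; rewrite -sum1_card; apply: eq_bigl => s.
  rewrite !inE; case: (s j =P a) => [sj|]; rewrite ?andbF ?andbT//.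
  apply: eq_forallb => b; rewrite (cnt_setD1 _ _ jJ) sj -[t b](tdE a)//.
  by rewrite eqn_add2r.
have jJ' : j \notin J :\ j by rewrite !inE eqxx.
rewrite J1 expnS factS.
have term a : (0 < t a)%N ->
  (#|[set s in type_class (J :\ j) (td a) | s j == a]| * \prod_b (t b)`! * (#|A| * #|A| ^ #|J :\ j|)
   = t a * ((#|J :\ j|)`! * #|A| ^ N))%N.
  move=> ta.
  have tdJ : (\sum_b td a b)%N = #|J :\ j|.
    apply: succn_inj; rewrite -J1 -tJ -addn1.
    rewrite -[in RHS](eq_bigr _ (fun b _ => tdE a b ta)) big_split/=.
    congr (_ + _)%N; rewrite (bigD1 a)//= eqxx big1 // => b /negbTE.
    by rewrite eq_sym => ->.
  have Jn' : (#|J :\ j| < n)%N by move: Jn; rewrite J1.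
  rewrite -(IHn _ _ Jn' tdJ).
  rewrite -(card_type_class_color a _ jJ').
  have -> : (\prod_b (t b)`! = t a * \prod_b (td a b)`!)%N.
    rewrite (bigD1 a)//= [in RHS](bigD1 a)//= mulnA; congr (_ * _)%N.
      by rewrite /td eqxx; case: (t a) ta => // m _; rewrite subn1 factS.
    by apply: eq_bigr => b /negbTE; rewrite /td eq_sym => ->; rewrite subn0.
  by ring.
rewrite !big_distrl/= (eq_bigr _ term) -big_distrl/=.
have -> : (\sum_(a | 0 < t a) t a = #|J|)%N.
  rewrite -tJ [RHS](bigID (fun a => 0 < t a)%N)/= [X in (_ + X)%N]big1 ?addn0//.
  by move=> a; rewrite -eqn0Ngt => /eqP.
by rewrite J1; ring.
Qed.

End types.

(** By induction on m, from (k m + k)! >= (k m)! (k m)^k. *)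
Lemma fact_balanced_bound (k m : nat) : (0 < m)%N ->
  (m`! ^ k * k ^ (k * m) <= k ^ k * m ^ k * (k * m)`!)%N.
Proof.
elim: m => // m IHm _; have [->|m0] := posnP m.
  by rewrite (_ : 1`! = 1)%N// muln1 !exp1n muln1 mul1n leq_pmulr// fact_gt0.
have step j : ((k * m)`! * (k * m) ^ j <= (k * m + j)`!)%N.
  elim: j => [|j IHj]; first by rewrite muln1 addn0.
  by rewrite addnS factS expnS mulnCA leq_mul// ltnW// ltnS leq_addr.
have ab : (m`! ^ k * k ^ (k * m) <= (k * m + k)`!)%N.
  by apply: leq_trans (IHm m0) _; have := step k; rewrite expnMn mulnC.
rewrite factS expnMn mulnS expnD [(k + _)%N]addnC.
have -> : (m.+1 ^ k * m`! ^ k * (k ^ k * k ^ (k * m)) =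
  k ^ k * m.+1 ^ k * (m`! ^ k * k ^ (k * m)))%N by ring.
exact: leq_mul.
Qed.

(** * Overlaps *)

Section overlaps.
Variables (R : realFieldType) (N : nat).

Lemma sum_eq_color (A : finType) (J : {set 'I_N}) (s : {ffun 'I_N -> A}) :
  \sum_(i in J) \sum_(j in J) (s i == s j)%:R = \sum_a (cnt J s a)%:R ^+ 2 :> R.
Proof.
transitivity (\sum_(i in J) (cnt J s (s i))%:R : R).
  apply: eq_bigr => i _; rewrite /cnt -sum1_card natr_sum.
  rewrite [LHS]big_mkcond [RHS]big_mkcond; apply: eq_bigr => j _.
  by rewrite inE eq_sym; case: ifP => //= _; case: eqP.
rewrite (sum_cnt_gen J s (fun a => (cnt J s a)%:R)).
by apply: eq_bigr => a _; rewrite expr2 mulr_natr.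
Qed.

Variable k : nat.
Implicit Types (J : {set 'I_N}) (s t : {ffun 'I_N -> 'I_k}).

Definition pair_color s t : {ffun 'I_N -> 'I_k * 'I_k} := [ffun i => (s i, t i)].

Definition centered s (i j : 'I_N) : R := (s i == s j)%:R - k%:R^-1.

(** For J the set of all sites, this is N times the covariance of the energies of
    s and t.  The restriction to J serves configurations that are balanced on
    J only. *)
Definition overlap J s t : R :=
  \sum_(i in J) \sum_(j in J) centered s i j * centered t i j.

Lemma overlapE J s t : overlap J s t =
  \sum_c (cnt J (pair_color s t) c)%:R ^+ 2
  - k%:R^-1 * \sum_a (cnt J s a)%:R ^+ 2 - k%:R^-1 * \sum_a (cnt J t a)%:R ^+ 2
  + (#|J|%:R / k%:R) ^+ 2.
Proof.
rewrite -!sum_eq_color /overlap !mulr_sumr -!sumrB.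
have -> : (#|J|%:R / k%:R) ^+ 2 = \sum_(i in J) \sum_(j in J) k%:R^-1 ^+ 2 :> R.
  rewrite !sumr_const -[RHS]mulr_natl -(mulr_natl (k%:R^-1 ^+ 2)) exprMn expr2.
  by rewrite mulrA.
rewrite -big_split; apply: eq_bigr => i _ /=.
rewrite !mulr_sumr -!sumrB -big_split; apply: eq_bigr => j _ /=.
rewrite /centered !ffunE xpair_eqE -mulnb natrM; ring.
Qed.

Lemma sum_pair_color_cnt J s t a :
  (\sum_b cnt J (pair_color s t) (a, b) = cnt J s a)%N.
Proof.
rewrite /cnt -[RHS]sum1_card (partition_big t xpredT)//=.
apply: eq_bigr => b _; rewrite -sum1_card; apply: eq_bigl => i.
by rewrite !inE ffunE xpair_eqE andbA.
Qed.

Lemma centered_norm s i j : (0 < k)%N -> `|centered s i j| <= 1.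
Proof.
move=> k0; have k1 : k%:R^-1 <= 1 :> R by rewrite invf_le1 ?ltr0n// ler1n.
have k0' : 0 <= k%:R^-1 :> R by rewrite invr_ge0.
rewrite /centered; move: k1 k0'; move: k%:R^-1 => z z1 z0.
by rewrite ler_norml; case: (_ == _) => /=; lra.
Qed.

Lemma overlap_restrict J s t : (0 < k)%N ->
  `|overlap [set: 'I_N] s t - overlap J s t| <= N%:R ^+ 2 - #|J|%:R ^+ 2.
Proof.
move=> k0.
pose F i j := centered s i j * centered t i j.
have E : overlap [set: 'I_N] s t - overlap J s t =
    \sum_i \sum_j (if (i \in J) && (j \in J) then 0 else F i j).
  have -> : overlap [set: 'I_N] s t = \sum_i \sum_j F i j.
    apply: eq_big => [i|i _]; first by rewrite finset.in_setT.
    by apply: eq_bigl => j; rewrite finset.in_setT.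
  have -> : overlap J s t = \sum_i \sum_j (if (i \in J) && (j \in J) then F i j else 0).
    rewrite /overlap big_mkcond; apply: eq_bigr => i _.
    by case: ifP => iJ /=; [rewrite big_mkcond|rewrite big1].
  rewrite -sumrB; apply: eq_bigr => i _; rewrite -sumrB; apply: eq_bigr => j _.
  by case: ifP; rewrite ?subrr ?subr0.
rewrite E; have -> : N%:R ^+ 2 - #|J|%:R ^+ 2 =
    \sum_(i < N) \sum_(j < N) (if (i \in J) && (j \in J) then 0 else 1) :> R.
  transitivity (\sum_(i < N) (N%:R - (if i \in J then #|J|%:R else 0)) : R).
    rewrite sumrB sumr_const card_ord expr2 -(mulr_natl N%:R); congr (_ - _).
    by rewrite -big_mkcond/= sumr_const -(mulr_natl #|J|%:R) expr2.
  apply: eq_bigr => i _; case: ifP => iJ /=; last first.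
    by rewrite subr0 sumr_const card_ord.
  have {1}-> : N%:R = \sum_(j < N) (1 : R) by rewrite sumr_const card_ord.
  rewrite -sum1_card natr_sum (big_mkcond (mem J)) -sumrB; apply: eq_bigr => j _.
  by rewrite /=; case: ifP; rewrite ?subrr ?subr0.
rewrite (le_trans (ler_norm_sum _ _ _))//; apply: ler_sum => i _.
rewrite (le_trans (ler_norm_sum _ _ _))//; apply: ler_sum => j _.
case: ifP => _; first by rewrite normr0.
by rewrite normrM mulr_ile1// centered_norm.
Qed.

End overlaps.

Lemma sum_sqr_ge (R : realFieldType) (A : finType) (n : A -> nat) (M : nat) :
  (0 < #|A|)%N -> (\sum_a n a)%N = M ->
  M%:R ^+ 2 / #|A|%:R <= \sum_a (n a)%:R ^+ 2 :> R.
Proof.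
move=> A0 nM.
have nMr : \sum_a (n a)%:R = M%:R :> R by rewrite -nM natr_sum.
move: nMr; move: M%:R => m nMr.
have k0 : 0 < #|A|%:R :> R by rewrite ltr0n.
have : 0 <= \sum_a ((n a)%:R - m / #|A|%:R) ^+ 2.
  by apply: sumr_ge0 => a _; exact: sqr_ge0.
have -> : \sum_a ((n a)%:R - m / #|A|%:R) ^+ 2 =
    \sum_a (n a)%:R ^+ 2 - m ^+ 2 / #|A|%:R.
  transitivity (\sum_a ((n a)%:R ^+ 2 - 2 * (m / #|A|%:R) * (n a)%:R + (m / #|A|%:R) ^+ 2)).
    by apply: eq_bigr => a _; ring.
  rewrite !(big_split, sumrN)/= sumr_const -mulr_sumr nMr -(mulr_natl (_ ^+ 2)).
  move: k0; by move: #|A|%:R => k k0; field; rewrite gt_eqF.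
by rewrite subr_ge0.
Qed.

(** * First and second moment sums *)

Section exponential_sums.
Variable R : realType.

Lemma expR_entropy (N : nat) (A : finType) (J : {set 'I_N}) (s : {ffun 'I_N -> A}) :
  expR (\sum_a (cnt J s a)%:R * ln (#|A|%:R * (cnt J s a)%:R / #|J|%:R)) =
  #|A|%:R ^+ #|J| * \prod_(i in J) ((cnt J s (s i))%:R / #|J|%:R) :> R.
Proof.
rewrite -prodr_const -big_split/=.
transitivity (\prod_(i in J) expR (ln (#|A|%:R * (cnt J s (s i))%:R / #|J|%:R)) : R).
  rewrite -expR_sum; congr expR.
  rewrite (sum_cnt_gen J s (fun a => ln (#|A|%:R * (cnt J s a)%:R / #|J|%:R))).
  by apply: eq_bigr => a _; rewrite mulr_natl.
apply: eq_bigr => i iJ; rewrite lnK ?mulrA// posrE.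
have J0 : (0 < #|J|)%N by apply/card_gt0P; exists i.
have A0 : (0 < #|A|)%N by apply/card_gt0P; exists (s i).
have c0 : (0 < cnt J s (s i))%N by apply/card_gt0P; exists i; rewrite inE iJ eqxx.
by rewrite divr_gt0 ?mulr_gt0 ?ltr0n.
Qed.

(** By [expR_entropy], exp of |J| times the relative entropy of the type is the
    inverse uniform weight times the product in [types_bound]. *)
Lemma sum_expR_entropy (N : nat) (A : finType) (J : {set 'I_N}) :
  \sum_(s : {ffun 'I_N -> A})
    expR (\sum_a (cnt J s a)%:R * ln (#|A|%:R * (cnt J s a)%:R / #|J|%:R)) <=
  (#|J|.+1 ^ #|A| * #|A| ^ N)%:R :> R.
Proof.
under eq_bigr do rewrite expR_entropy.
rewrite -mulr_sumr.
have JN : (#|J| <= N)%N by rewrite -[leqRHS]card_ord max_card.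
apply: (@le_trans _ _ (#|A|%:R ^+ #|J| * (#|J|.+1 ^ #|A| * #|A| ^ (N - #|J|))%:R)).
  by rewrite ler_wpM2l ?types_bound// exprn_ge0.
rewrite -natrX -natrM ler_nat mulnCA -expnD subnKC//.
Qed.

Variables (N k : nat) (N0 : (0 < N)%N) (k3 : (3 <= k)%N) (b : R).
Let K : R := k%:R.
Let C : R := K * potts_const K.
Let N' : R := N%:R.

Let K2 : 2 < K. Proof. by rewrite /K (ltr_nat R 2). Qed.
Let K0 : 0 < K. Proof. exact: lt_trans K2. Qed.
Let N'0 : 0 < N'. Proof. by rewrite /N' ltr0n. Qed.

(** The excess of the overlap over its balanced value is absorbed by the entropy
    of the colour counts, through [entropy_chi2]. *)
Lemma sum_expR_overlap_diag : b ^+ 2 * (1 - 2 / K) <= 2 * C ->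
  \sum_(s : {ffun 'I_N -> 'I_k}) expR (b ^+ 2 / (2 * N') * overlap R [set: 'I_N] s s) <=
  expR (b ^+ 2 * N' * (K - 1) / (2 * K ^+ 2)) * (N.+1 ^ k * k ^ N)%:R.
Proof.
move=> bC.
have := @sum_expR_entropy N 'I_k [set: 'I_N]; rewrite cardsT !card_ord => H.
apply: (le_trans _ (ler_wpM2l (expR_ge0 _) H)).
rewrite mulr_sumr; apply: ler_sum => s _; rewrite -expRD ler_expR.
set n := cnt [set: 'I_N] s.
have sn : (\sum_a n a)%N = N by rewrite sum_cnt cardsT card_ord.
have kA : K = #|'I_k|%:R by rewrite card_ord.
have := entropy_chi2 K2 kA sn; rewrite -/C -/N'.
have : N' ^+ 2 / K <= \sum_a (n a)%:R ^+ 2.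
  by rewrite kA; apply: (sum_sqr_ge R) => //; rewrite card_ord (leq_trans _ k3).
have diag : \sum_c (cnt [set: 'I_N] (pair_color s s) c)%:R ^+ 2 = \sum_a (n a)%:R ^+ 2 :> R.
  rewrite -!sum_eq_color; apply: eq_bigr => i _; apply: eq_bigr => j _.
  by rewrite !ffunE xpair_eqE andbb.
rewrite overlapE diag cardsT card_ord -/n -/K -/N' -mulr_suml.
move: (\sum_a (n a)%:R ^+ 2) => S; set X := \sum_a _ => SN.
have -> : b ^+ 2 / (2 * N') * (S - K^-1 * S - K^-1 * S + (N' / K) ^+ 2) =
   b ^+ 2 * N' * (K - 1) / (2 * K ^+ 2) + b ^+ 2 * (1 - 2 / K) / 2 * (S / N' - N' / K).
  by field; rewrite !gt_eqF.
move=> H2; rewrite lerD2l (le_trans _ H2)// ler_wpM2r//.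
  by rewrite subr_ge0 ler_pdivlMr// mulrAC -expr2.
by rewrite ler_pdivrMr// [C * 2]mulrC.
Qed.

Variable m : nat.
Hypothesis m0 : (0 < m)%N.
Variable J : {set 'I_N}.
Hypothesis Jm : #|J| = (k * m)%N.

Let S := type_class J (fun _ : 'I_k => m).

Lemma type_class_cnt s a : s \in S -> cnt J s a = m.
Proof. by rewrite inE => /forallP/(_ a)/eqP. Qed.

Lemma overlap_type_class s t : s \in S -> t \in S ->
  overlap R J s t = \sum_c (cnt J (pair_color s t) c)%:R ^+ 2 - m%:R ^+ 2.
Proof.
move=> sS tS; rewrite overlapE Jm.
have E u : u \in S -> \sum_a (cnt J u a)%:R ^+ 2 = K * m%:R ^+ 2 :> R.
  move=> uS; under eq_bigr do rewrite (type_class_cnt _ uS).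
  by rewrite sumr_const card_ord mulr_natl.
rewrite !E// -/K natrM -/K.
by field; rewrite gt_eqF.
Qed.

Lemma overlap_type_class_diag s : s \in S -> overlap R J s s = m%:R ^+ 2 * (K - 1).
Proof.
move=> sS; rewrite overlap_type_class//.
have -> : \sum_c (cnt J (pair_color s s) c)%:R ^+ 2 = \sum_a (cnt J s a)%:R ^+ 2 :> R.
  rewrite -!sum_eq_color; apply: eq_bigr => i _; apply: eq_bigr => j _.
  by rewrite !ffunE xpair_eqE andbb.
under eq_bigr do rewrite (type_class_cnt _ sS).
by rewrite sumr_const card_ord -(mulr_natl (_ ^+ 2)) -/K; ring.
Qed.

(** Each row of the matrix of joint counts has total m, so [entropy_chi2] applies
    to it with k colours; summing the rows gives the relative entropy of the
    joint type, with alphabet of size k^2. *)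
Lemma overlap_le_entropy s t : s \in S -> t \in S -> b ^+ 2 <= K * C ->
  b ^+ 2 / N' * overlap R J s t <=
  \sum_c (cnt J (pair_color s t) c)%:R *
    ln (#|{: 'I_k * 'I_k}|%:R * (cnt J (pair_color s t) c)%:R / #|J|%:R).
Proof.
move=> sS tS bC; rewrite overlap_type_class//.
pose n (a b : 'I_k) := cnt J (pair_color s t) (a, b).
have row a : (\sum_b n a b)%N = m by rewrite sum_pair_color_cnt type_class_cnt.
have m'0 : 0 < m%:R :> R by rewrite ltr0n.
have kA : K = #|'I_k|%:R by rewrite card_ord.
have E1 : \sum_c (cnt J (pair_color s t) c)%:R ^+ 2 = \sum_a \sum_b (n a b)%:R ^+ 2 :> R.
  by rewrite pair_bigA/=; apply: eq_bigr => -[].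
have sq : m%:R ^+ 2 <= \sum_a \sum_b (n a b)%:R ^+ 2 :> R.
  apply: (@le_trans _ _ (\sum_(a < k) (m%:R ^+ 2 / K))).
    by rewrite sumr_const card_ord -(mulr_natl (_ / _)) -/K mulrC divfK// gt_eqF.
  apply: ler_sum => a _; rewrite kA; apply: sum_sqr_ge (row a).
  by rewrite card_ord (leq_trans _ k3).
have kmN : K * m%:R <= N'.
  by rewrite /K /N' -natrM ler_nat -Jm -[leqRHS]card_ord max_card.
rewrite E1.
apply: (@le_trans _ _ (C / m%:R * (\sum_a \sum_b (n a b)%:R ^+ 2 - m%:R ^+ 2))).
  rewrite ler_wpM2r ?subr_ge0// ler_pdivrMr// mulrAC ler_pdivlMr//.
  have C0 : 0 <= C.
    have : 0 <= K * C by rewrite (le_trans _ bC)// sqr_ge0.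
    by rewrite pmulr_rge0.
  apply: (@le_trans _ _ (K * C * m%:R)); first by rewrite ler_wpM2r// ltW.
  by rewrite -mulrA mulrCA ler_wpM2l.
have -> : C / m%:R * (\sum_a \sum_b (n a b)%:R ^+ 2 - m%:R ^+ 2) =
   \sum_(a < k) C * (\sum_b (n a b)%:R ^+ 2 / m%:R - m%:R / K).
  rewrite -mulr_sumr sumrB sumr_const card_ord -(mulr_natl (_ / _)) -/K.
  under [in RHS]eq_bigr do rewrite -mulr_suml.
  rewrite -mulr_suml; move: (\sum_a _) => T; move: m'0; move: m%:R => m' m'0.
  by field; rewrite !gt_eqF.
apply: (@le_trans _ _ (\sum_a \sum_b (n a b)%:R * ln (K * (n a b)%:R / m%:R))).
  by apply: ler_sum => a _; exact: entropy_chi2 K2 kA (row a).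
rewrite pair_bigA/=; apply: ler_sum => -[a b'] _ /=.
rewrite -/(n a b') Jm card_prod card_ord !natrM -/K.
suff -> : K * K * (n a b')%:R / (K * m%:R) = K * (n a b')%:R / m%:R by [].
by move: m'0; move: m%:R => m' m'0; field; rewrite !gt_eqF.
Qed.

Lemma sum_expR_overlap : b ^+ 2 <= K * C ->
  \sum_(s in S) \sum_(t in S) expR (b ^+ 2 / N' * overlap R J s t) <=
  (N.+1 ^ (k * k) * (k * k) ^ N)%:R.
Proof.
move=> bC.
have := @sum_expR_entropy N ('I_k * 'I_k)%type J.
set F := BIG_F; rewrite card_prod card_ord => H.
apply: (@le_trans _ _ (\sum_u F u)); last first.
  apply: (le_trans H); rewrite ler_nat leq_mul// leq_exp2r ?muln_gt0 ?(leq_trans _ k3)//.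
  by rewrite ltnS -[leqRHS]card_ord max_card.
rewrite pair_big_dep/=.
rewrite (reindex (fun u : {ffun 'I_N -> 'I_k * 'I_k} =>
  ([ffun i => (u i).1], [ffun i => (u i).2]) : {ffun 'I_N -> 'I_k} * {ffun 'I_N -> 'I_k}))/=; last first.
  exists (fun st => pair_color st.1 st.2) => [u _|[s t] _].
    by apply/ffunP => i; rewrite !ffunE -surjective_pairing.
  by congr (_, _); apply/ffunP => i; rewrite !ffunE.
rewrite big_mkcond; apply: ler_sum => u _; case: ifP => [/andP[sS tS]|_]; last exact: expR_ge0.
rewrite /F ler_expR (le_trans (overlap_le_entropy sS tS bC))//.
set u' := pair_color _ _; have -> : u' = u.
  by apply/ffunP => i; rewrite !ffunE -surjective_pairing.
by [].
Qed.

(** Cancel (k m)! between [card_type_class] and [fact_balanced_bound]. *)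
Lemma card_type_class_ge : (k ^ N <= #|S| * (k ^ k * m ^ k))%N.
Proof.
have := @card_type_class N 'I_k J (fun _ => m).
rewrite sum_nat_const !card_ord Jm => /(_ erefl).
rewrite prod_nat_const card_ord -/S => H.
rewrite -(leq_pmul2l (fact_gt0 (k * m))) -H -mulnA [leqRHS]mulnCA leq_mul2l.
by rewrite [X in (_ <= X)%N]mulnC fact_balanced_bound// orbT.
Qed.

Lemma card_type_class_gt0 : (0 < #|S|)%N.
Proof.
have := card_type_class_ge; rewrite lt0n; apply: contraTneq => ->.
by rewrite mul0n -ltnNge expn_gt0 (leq_trans _ k3).
Qed.

End exponential_sums.

(** * Gaussian concentration *)

(** Uniqueness of the Radon-Nikodym derivative identifies it with [normal_pdf]. *)
Lemma integral_gaussE (R : realType) (f : R -> \bar R) :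
  measurable_fun [set: R] f -> (forall x, (0 <= f x)%E) ->
  (\int[normal_prob (0:R) 1]_x f x
     = \int[lebesgue_measure]_x (f x * (normal_pdf 0 1 x)%:E))%E.
Proof.
move=> mf f0; have dom := @normal_prob_dominates R 0 1.
rewrite -(Radon_Nikodym_SigmaFinite.change_of_variables dom)//=.
have mpdf : measurable_fun setT (EFin \o normal_pdf (0 : R) 1).
  by apply/measurable_EFinP; exact: measurable_normal_pdf.
have idens := Radon_Nikodym_SigmaFinite.f_integrable dom.
apply: ae_eq_integral => //.
- by apply: emeasurable_funM => //; exact: (measurable_int (@lebesgue_measure R)).
- exact: emeasurable_funM.
- apply: ae_eqe_mul2l; apply: integral_ae_eq => //= E _ mE.
  by rewrite -(Radon_Nikodym_SigmaFinite.f_integral dom).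
Qed.

(** Completing the square turns the integrand into a constant times the normal
    density of mean t. *)
Lemma gauss_mgf (R : realType) (t : R) :
  (\int[normal_prob (0:R) 1]_x (expR (t * x))%:E = (expR (t ^+ 2 / 2))%:E)%E.
Proof.
rewrite integral_gaussE//; last first.
  by apply/measurable_EFinP; apply: measurableT_comp => //; exact: measurable_funM.
under eq_integral => x _.
  rewrite (_ : _ * _ = (expR (t ^+ 2 / 2))%:E * (normal_pdf t 1 x)%:E)%E; last first.
    rewrite -!EFinM !normal_pdfE ?oner_neq0// /normal_fun; congr EFin.
    rewrite mulrCA [RHS]mulrCA -!expRD; congr (_ * expR _).
    by field.
  over.
rewrite ge0_integralZl//.
- by rewrite integral_normal_pdf mule1.
- apply/measurable_EFinP; exact: measurable_normal_pdf.
- by move=> x _; rewrite lee_fin normal_pdf_ge0.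
Qed.

(** Monotonicity of cosh in the absolute value. *)
Lemma expR_sym_le (R : realType) (s t : R) :
  `|s| <= `|t| -> expR s + expR (- s) <= expR t + expR (- t).
Proof.
have E (u : R) : expR u + expR (- u) = expR `|u| + expR (- `|u|).
  by case: (ger0P u) => // _; rewrite opprK addrC.
rewrite (E s) (E t); move: `|s| `|t| (normr_ge0 s) => {E}s {}t s0 st.
have e1 : expR (- s - t) <= 1 :> R by rewrite -expR0 ler_expR; lra.
have est : expR s <= expR t by rewrite ler_expR.
have Et : expR (- t) = expR s * expR (- s - t) by rewrite -expRD; congr expR; lra.
have Es : expR (- s) = expR t * expR (- s - t) by rewrite -expRD; congr expR; lra.
by rewrite Et Es; nra.
Qed.

Lemma normr_le_expR_sym (R : realType) (x : R) : `|x| <= expR x + expR (- x).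
Proof.
have := expR_ge1Dx x; have := expR_ge1Dx (- x).
have := expR_ge0 x; have := expR_ge0 (- x).
by case: (ger0P x) => _; lra.
Qed.

Section probability_integrals.
Context d (T : measurableType d) (R : realType) (P : probability T R).
Implicit Types f : T -> R.

Lemma integrable_le f g : measurable_fun setT f ->
  P.-integrable setT (EFin \o g) -> (forall x, `|f x| <= g x) ->
  P.-integrable setT (EFin \o f).
Proof.
move=> mf ig fg; apply: le_integrable ig => //; first exact/measurable_EFinP.
by move=> x _ /=; rewrite lee_fin (le_trans (fg x))// ler_norm.
Qed.

Lemma integrable_ge0 f (r : R) : measurable_fun setT f -> (forall x, 0 <= f x) ->
  (\int[P]_x (f x)%:E = r%:E)%E -> P.-integrable setT (EFin \o f).
Proof.
move=> mf f0 fr; apply/integrableP; split; first exact/measurable_EFinP.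
under eq_integral do rewrite /= ger0_norm//.
by rewrite fr ltry.
Qed.

Lemma integrable_const (r : R) : P.-integrable setT (EFin \o (fun _ : T => r)).
Proof. by apply: finite_measure_integrable_cst. Qed.

Lemma integrable_add f g : P.-integrable setT (EFin \o f) ->
  P.-integrable setT (EFin \o g) ->
  P.-integrable setT (EFin \o (fun x => f x + g x)).
Proof. by move=> fi gi; exact: (integrableD measurableT fi gi). Qed.

Lemma integrable_scale f (r : R) : P.-integrable setT (EFin \o f) ->
  P.-integrable setT (EFin \o (fun x => r * f x)).
Proof. by move=> fi; exact: (integrableZl measurableT r fi). Qed.

Lemma integrable_opp f : P.-integrable setT (EFin \o f) ->
  P.-integrable setT (EFin \o (fun x => - f x)).
Proof.
move=> /(integrable_scale (-1)).
by rewrite (_ : (fun x => -1 * f x) = (fun x => - f x))//; apply/funext => x; rewrite mulN1r.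
Qed.

Lemma Rintegral_const (r : R) : \int[P]_x r = r.
Proof. by rewrite Rintegral_cst//= probability_setT /= mulr1. Qed.

(** Integrate the tangent inequality exp y >= exp m (1 + y - m) at the mean m. *)
Lemma jensen_expR f : P.-integrable setT (EFin \o f) ->
  P.-integrable setT (EFin \o (expR \o f)) ->
  expR (\int[P]_x f x) <= \int[P]_x expR (f x).
Proof.
move=> fi ei; set m := \int[P]_x f x.
have -> : expR m = \int[P]_x (expR m * (f x + (1 - m))).
  rewrite RintegralZl//; last first.
    exact: integrable_add (integrable_const _).
  rewrite RintegralD//; last exact: integrable_const.
  by rewrite Rintegral_const -/m; ring.
apply: le_Rintegral => //.
  apply: integrable_scale.
  exact: integrable_add (integrable_const _).
move=> x _; rewrite (_ : f x = m + (f x - m)); last by ring.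
rewrite expRD ler_wpM2l ?expR_ge0//.
by have := expR_ge1Dx (f x - m); lra.
Qed.

Lemma integrable_bigsum (J : Type) (s : seq J) (A : pred J) (f : J -> T -> R) :
  (forall j, A j -> P.-integrable setT (EFin \o f j)) ->
  P.-integrable setT (EFin \o (fun x => \sum_(j <- s | A j) f j x)).
Proof.
move=> fi.
rewrite (_ : EFin \o _ = fun x => (\sum_(j <- s | A j) (f j x)%:E)%E).
  exact: integrable_sum.
by apply/funext => x; rewrite sumEFin.
Qed.

Lemma Rintegral_bigsum (J : Type) (s : seq J) (A : pred J) (f : J -> T -> R) :
  (forall j, P.-integrable setT (EFin \o f j)) ->
  \int[P]_x (\sum_(j <- s | A j) f j x) = \sum_(j <- s | A j) \int[P]_x f j x.
Proof.
move=> fi; rewrite /Rintegral; under eq_integral do rewrite -sumEFin.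
rewrite integral_sum//= -sum_fine// => j _; exact: integrable_fin_num (fi j).
Qed.

End probability_integrals.

Notation gauss R := (@normal_prob R 0 1).

Lemma gauss_integrable_expR (R : realType) (t : R) :
  (gauss R).-integrable setT (EFin \o (fun x => expR (t * x))).
Proof.
apply: integrable_ge0 (gauss_mgf t) => [|x]; last exact: expR_ge0.
by apply: measurableT_comp => //; exact: measurable_funM.
Qed.

Lemma Rintegral_gauss_expR (R : realType) (t : R) :
  \int[gauss R]_x (expR (t * x)) = expR (t ^+ 2 / 2).
Proof. by rewrite /Rintegral gauss_mgf. Qed.

Section lipschitz1.
Context (R : realType) (g : R -> R) (L : R).
Hypotheses (L0 : 0 <= L) (gL : forall x y, `|g x - g y| <= L * `|x - y|).

Lemma lipschitz_measurable : measurable_fun setT g.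
Proof.
apply: continuous_measurable_fun => x.
have [L00|Ln0] := eqVneq L 0.
  have -> : g = cst (g 0).
    apply/funext => y; apply/eqP; rewrite -subr_eq0 -normr_le0 /=.
    by rewrite (le_trans (gL _ _))// L00 mul0r.
  exact: cvg_cst.
apply/(@cvgrPdist_le _ R^o) => e e0.
have eL : 0 < e / L by rewrite divr_gt0// lt0r Ln0.
near=> y; apply: (le_trans (gL _ _)).
rewrite -ler_pdivlMl ?lt0r ?Ln0// mulrC.
near: y; exact: (@cvgr_dist_le _ R^o _ _ _ _ _ (@cvg_id _ (nbhs x)) _ eL).
Unshelve. all: by end_near. Qed.

Let bound x : expR (g x) <= expR (g 0) * (expR (L * x) + expR (- L * x)).
Proof.
rewrite -{1}(subrK (g 0) (g x)) addrC expRD ler_wpM2l ?expR_ge0//.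
apply: (@le_trans _ _ (expR (g x - g 0) + expR (- (g x - g 0)))).
  by rewrite lerDl expR_ge0.
rewrite mulNr; apply: expR_sym_le; rewrite normrM (ger0_norm L0).
by rewrite -{2}(subr0 x).
Qed.

Lemma lipschitz_integrable_expR :
  (gauss R).-integrable setT (EFin \o (expR \o g)).
Proof.
apply: (@integrable_le _ _ _ (gauss R) _
  (fun x => expR (g 0) * (expR (L * x) + expR (- L * x)))).
- by apply: measurableT_comp => //; exact: lipschitz_measurable.
- apply: integrable_scale.
  by apply: integrable_add; exact: gauss_integrable_expR.
- by move=> x; rewrite /= ger0_norm ?expR_ge0.
Qed.

End lipschitz1.

Section gauss_concentration1.
Context (R : realType) (g : R -> R) (L : R).
Hypotheses (L0 : 0 <= L) (gL : forall x y, `|g x - g y| <= L * `|x - y|).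

Let gNL x y : `|(- g x) - (- g y)| <= L * `|x - y|.
Proof. by rewrite -opprD normrN. Qed.

Lemma lipschitz_integrable : (gauss R).-integrable setT (EFin \o g).
Proof.
apply: (@integrable_le _ _ _ (gauss R) _ (fun x => expR (g x) + expR (- g x))).
- exact: lipschitz_measurable gL.
- apply: integrable_add.
  + exact: (lipschitz_integrable_expR L0 gL).
  + exact: (lipschitz_integrable_expR L0 gNL).
- by move=> x; exact: normr_le_expR_sym.
Qed.

(** Symmetrisation: for independent X and Y, Jensen gives
    E exp (g X - E g) <= E exp (g X - g Y) = E cosh (g X - g Y), which is at most
    E cosh (L (X - Y)) = exp (L^2). *)
Lemma gauss_concentration1 :
  \int[gauss R]_x expR (g x) <= expR (\int[gauss R]_x g x + L ^+ 2).
Proof.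
have iA := lipschitz_integrable_expR L0 gL.
have iB := lipschitz_integrable_expR L0 gNL.
set m := \int[gauss R]_x g x.
pose a := \int[gauss R]_x expR (g x); pose b := \int[gauss R]_x expR (- g x).
have ig := lipschitz_integrable.
have bm : expR (- m) <= b.
  have -> : - m = \int[gauss R]_x (- g x).
    under eq_Rintegral do rewrite -mulN1r.
    by rewrite RintegralZl// mulN1r.
  apply: jensen_expR => //. exact: integrable_opp.
have a0 : 0 <= a by apply: Rintegral_ge0 => x _; exact: expR_ge0.
have iE t := gauss_integrable_expR t.
have iS (p q : R) : (gauss R).-integrable setT
    (EFin \o (fun y => p * expR (- g y) + q * expR (g y))).
  by apply: integrable_add; apply: integrable_scale.
have iS' (p q : R) : (gauss R).-integrable setT
    (EFin \o (fun y => p * expR (- L * y) + q * expR (L * y))).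
  by apply: integrable_add; apply: integrable_scale.
have S (p q : R) : \int[gauss R]_y (p * expR (- g y) + q * expR (g y)) = p * b + q * a.
  rewrite RintegralD//; try by apply: integrable_scale.
  by rewrite !RintegralZl.
have S' (p q : R) : \int[gauss R]_y (p * expR (- L * y) + q * expR (L * y))
    = (p + q) * expR (L ^+ 2 / 2).
  rewrite RintegralD//; try by apply: integrable_scale.
  by rewrite !RintegralZl// !Rintegral_gauss_expR sqrrN mulrDl.
have ab : a * b <= expR (L ^+ 2).
  have H x : expR (g x) * b + expR (- g x) * a
      <= (expR (L * x) + expR (- L * x)) * expR (L ^+ 2 / 2).
    rewrite -S -S'; apply: le_Rintegral => // y _.
    rewrite -!expRD; have := @expR_sym_le _ (g x - g y) (L * (x - y)).
    rewrite normrM (ger0_norm L0) => /(_ (gL x y)).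
    by rewrite !opprB !mulrBr opprB !mulNr [_ - g x]addrC [X in _ <= _ + expR X]addrC.
  have : \int[gauss R]_x (a * expR (- g x) + b * expR (g x)) <=
      \int[gauss R]_x (expR (L ^+ 2 / 2) * expR (- L * x) + expR (L ^+ 2 / 2) * expR (L * x)).
    apply: le_Rintegral; [by []|exact: iS|exact: iS'|].
    by move=> x _; have := H x; lra.
  rewrite S S' => H2.
  have -> : expR (L ^+ 2) = expR (L ^+ 2 / 2) * expR (L ^+ 2 / 2).
    by rewrite -expRD; congr expR; field.
  by lra.
rewrite expRD -/a.
have -> : a = expR m * (a * expR (- m)) by rewrite mulrCA -expRD subrr expR0 mulr1.
by rewrite ler_wpM2l ?expR_ge0// (le_trans _ ab)// ler_wpM2l.
Qed.

End gauss_concentration1.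

Section gauss_tuple.
Variable R : realType.

(** The domain carries [measurableTypeR] because this is the type on which
    [normal_prob] is a measure. *)
Definition tuple_cons n (yx : measurableTypeR R * n.-tuple R) : n.+1.-tuple R :=
  [the n.+1.-tuple R of yx.1 :: yx.2].

Lemma measurable_tuple_cons n : measurable_fun setT (@tuple_cons n).
Proof. exact: measurable_cons. Qed.

HB.instance Definition _ n :=
  isMeasurableFun.Build _ _ _ _ (@tuple_cons n) (@measurable_tuple_cons n).

Fixpoint gauss_tuple n : probability (n.-tuple R) R :=
  match n with
  | 0 => \d_([tuple] : 0.-tuple R)
  | m.+1 => distribution (gauss R \x gauss_tuple m)%E (@tuple_cons m)
  end.

Lemma ge0_integral_gauss_tupleS n (f : n.+1.-tuple R -> \bar R) :
  measurable_fun setT f -> (forall x, (0 <= f x)%E) ->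
  (\int[gauss_tuple n.+1]_x f x =
   \int[gauss R]_y \int[gauss_tuple n]_x f (tuple_cons (y, x)))%E.
Proof.
move=> mf f0; rewrite [LHS]ge0_integral_distribution//.
rewrite fubini_tonelli1//; first exact: measurableT_comp.
by move=> x; exact: f0.
Qed.

Definition box n (B : 'I_n -> set R) : set (n.-tuple R) :=
  [set x | forall i, B i (tnth x i)].

Lemma measurable_box n (B : 'I_n -> set R) :
  (forall i, measurable (B i)) -> measurable (box B).
Proof.
move=> mB; rewrite (_ : box B = \bigcap_(i in setT) ((@tnth n R)^~ i @^-1` B i)).
  apply: fin_bigcap_measurable => // i _.
  by rewrite -[X in measurable X]setTI; exact: measurable_tnth.
by apply/seteqP; split => [x xB i _|x xB i]; exact: xB.
Qed.

Lemma gauss_tuple_box n (B : 'I_n -> set R) : (forall i, measurable (B i)) ->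
  gauss_tuple n (box B) = (\prod_(i < n) gauss R (B i))%E.
Proof.
elim: n B => [|n IHn] B mB.
  rewrite big_ord0 /= diracE (_ : _ \in _)// inE => -[//].
rewrite big_ord_recl -IHn//= /distribution /pushforward.
rewrite (_ : _ @^-1` _ = B ord0 `*` box (fun i => B (lift ord0 i))).
  by rewrite product_measure1E; [|exact: mB|exact: measurable_box].
apply/seteqP; split => [[y x] /= H|[y x] [/= H0 H] i].
  by split => [|i]; [exact: (H ord0)|have := H (lift ord0 i); rewrite tnthS].
have [j ->|->//] := unliftP ord0 i.
by rewrite tnthS; exact: H.
Qed.

(** Boxes are closed under intersection and generate the sigma-algebra of tuples. *)
Lemma gauss_tuple_unique n (m : probability (n.-tuple R) R) :
  (forall B : 'I_n -> set R, (forall i, measurable (B i)) ->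
    m (box B) = (\prod_(i < n) gauss R (B i))%E) ->
  forall A, measurable A -> m A = gauss_tuple n A.
Proof.
move=> mbox A mA.
pose G : set (set (n.-tuple R)) :=
  [set A | exists B : 'I_n -> set R, (forall i, measurable (B i)) /\ A = box B].
apply: (measure_unique G (fun _ => setT)) => //.
- apply/seteqP; split.
    apply: smallest_sub; first exact: smallest_sigma_algebra.
    move=> C; rewrite -bigcup_seq => -[i _ /= [D mD <-]].
    rewrite setTI; apply: sub_sigma_algebra.
    exists (fun j => if j == i then D else setT); split => [j|].
      by case: ifP.
    apply/seteqP; split => [x Dx j|x /(_ i)]; last by rewrite eqxx.
    by case: eqP => // ->.
  apply: smallest_sub; first exact: sigma_algebra_measurable.
  by move=> _ [B [mB ->]]; exact: measurable_box.
- move=> _ _ [B [mB ->]] [C [mC ->]]; exists (fun i => B i `&` C i); split.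
    by move=> i; exact: measurableI.
  apply/seteqP; split => [x [xB xC] i //|x H].
  by split => i; have [] := H i.
- by move=> _; exists (fun _ => setT); split => //; apply/seteqP; split.
- by rewrite bigcup_const.
- move=> _ [B [mB ->]]; exact: (etrans (mbox B mB) (esym (gauss_tuple_box mB))).
- by move=> _; rewrite (le_lt_trans (probability_le1 _ _))// ltry.
Qed.

End gauss_tuple.

Section gauss_tuple_theory.
Variable R : realType.

Lemma integral_gauss_tupleS n (f : n.+1.-tuple R -> \bar R) :
  (gauss_tuple R n.+1).-integrable setT f ->
  (\int[gauss_tuple R n.+1]_x f x =
   \int[gauss R]_y \int[gauss_tuple R n]_x f (tuple_cons (y, x)))%E.
Proof.
move=> /integrableP[mf fy].
have ifc : (gauss R \x gauss_tuple R n)%E.-integrable setT (f \o @tuple_cons R n).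
  apply/integrableP; split; first exact: measurableT_comp.
  move: fy; rewrite [X in (X < _)%E]ge0_integral_distribution//.
  exact: measurableT_comp.
by rewrite [LHS]integral_distribution// -integral12_prod_meas1.
Qed.

Lemma measurable_linear n (c : 'I_n -> R) :
  measurable_fun setT (fun x : n.-tuple R => \sum_(i < n) c i * tnth x i).
Proof.
apply: measurable_sum => i; apply: measurable_funM => //.
exact: measurable_tnth.
Qed.

Lemma tuple_cons0 n (y : R) (x : n.-tuple R) : tnth (tuple_cons (y, x)) ord0 = y.
Proof. by []. Qed.

Lemma tuple_consS n (y : R) (x : n.-tuple R) i :
  tnth (tuple_cons (y, x)) (lift ord0 i) = tnth x i.
Proof. exact: tnthS. Qed.

(** By induction on n, integrating the first coordinate last. *)
Lemma gauss_tuple_mgf n (c : 'I_n -> R) :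
  (\int[gauss_tuple R n]_x (expR (\sum_(i < n) c i * tnth x i))%:E
    = (expR ((\sum_(i < n) c i ^+ 2) / 2))%:E)%E.
Proof.
elim: n c => [|n IHn] c.
  under eq_integral do rewrite big_ord0.
  rewrite big_ord0 mul0r integral_cst//= diracT mule1//.
rewrite ge0_integral_gauss_tupleS//; last first.
- apply/measurable_EFinP; apply: measurableT_comp => //.
  exact: measurable_linear.
under eq_integral => y _.
  under eq_integral => x _.
    rewrite big_ord_recl tuple_cons0 expRD EFinM.
    under eq_bigr => i _ do rewrite tuple_consS.
    over.
  rewrite ge0_integralZl//; last first.
  - apply/measurable_EFinP; apply: measurableT_comp => //.
    exact: (measurable_linear (fun i => c (lift ord0 i))).
  rewrite IHn muleC; over.
rewrite ge0_integralZl//; last first.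
- apply/measurable_EFinP; apply: measurableT_comp => //; exact: measurable_funM.
rewrite gauss_mgf -EFinM -expRD big_ord_recl; congr (expR _)%:E.
by rewrite mulrDl addrC.
Qed.

Lemma gauss_tuple_integrable_tnth n (i : 'I_n) :
  (gauss_tuple R n).-integrable setT (EFin \o (fun x => tnth x i)).
Proof.
have iE (t : R) : (gauss_tuple R n).-integrable setT
    (EFin \o (fun x => expR (t * tnth x i))).
  have mE : measurable_fun setT (fun x : n.-tuple R => expR (t * tnth x i)).
    by apply: measurableT_comp => //; apply: measurable_funM => //; exact: measurable_tnth.
  have := gauss_tuple_mgf (fun j : 'I_n => if j == i then t else 0).
  under eq_integral => x _.
    rewrite (bigD1 i)//= eqxx big1 ?addr0; last by move=> j /negbTE ->; rewrite mul0r.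
    over.
  by apply: integrable_ge0 => // x; exact: expR_ge0.
apply: (@integrable_le _ _ _ (gauss_tuple R n) _ (fun x => expR (1 * tnth x i) + expR (- 1 * tnth x i))).
- exact: measurable_tnth.
- exact: integrable_add.
- by move=> x; rewrite mul1r mulN1r normr_le_expR_sym.
Qed.

Definition coord_lipschitz n (L : 'I_n -> R) (f : n.-tuple R -> R) :=
  forall x y, `|f x - f y| <= \sum_(i < n) L i * `|tnth x i - tnth y i|.

Lemma coord_lipschitz_integrable n (L : 'I_n -> R) f :
  measurable_fun setT f -> coord_lipschitz L f ->
  (gauss_tuple R n).-integrable setT (EFin \o f).
Proof.
move=> mf Lf.
pose z : n.-tuple R := [tuple 0 | i < n].
apply: (@integrable_le _ _ _ (gauss_tuple R n) _
  (fun x => `|f z| + \sum_(i < n) L i * `|tnth x i|)) => //.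
  apply: integrable_add; first exact: integrable_const.
  rewrite (_ : EFin \o _ =
    fun x => (\sum_(i < n) (L i * `|tnth x i|)%:E)%E); last first.
    by apply/funext => x; rewrite sumEFin.
  apply: integrable_sum => // i _; apply: integrable_scale.
  exact: (integrable_norm (gauss_tuple_integrable_tnth i)).
move=> x; rewrite -[f x](subrK (f z)) addrC (le_trans (ler_normD _ _))//.
rewrite lerD2l (le_trans (Lf _ _))//; apply: ler_sum => i _.
by rewrite tnth_mktuple subr0.
Qed.

(** The mean over the last n coordinates is a Lipschitz function of the first one:
    the induction hypothesis controls the inner integral of exp f, and
    [gauss_concentration1] the outer one. *)
Lemma gauss_tuple_concentration n (L : 'I_n -> R) f :
  (forall i, 0 <= L i) -> measurable_fun setT f -> coord_lipschitz L f ->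
  (\int[gauss_tuple R n]_x (expR (f x))%:E <=
   (expR (\int[gauss_tuple R n]_x f x + \sum_(i < n) L i ^+ 2)%R)%:E)%E.
Proof.
elim: n L f => [|n IHn] L f L0 mf Lf.
  have fE x : f x = f [tuple] by rewrite [x]tuple0.
  under eq_integral do rewrite fE.
  under eq_Rintegral do rewrite fE.
  rewrite integral_cst//= probability_setT mule1 Rintegral_const.
  by rewrite big_ord0 addr0.
pose L' i := L (lift ord0 i).
pose h y x := f (tuple_cons (y, x)).
have mh y : measurable_fun setT (h y).
  exact: (measurableT_comp (measurableT_comp mf (@measurable_tuple_cons R n)) (pair1_measurable y)).
have Lh y : coord_lipschitz L' (h y).
  move=> x1 x2; apply: (le_trans (Lf _ _)).
  rewrite big_ord_recl !tuple_cons0 subrr normr0 mulr0 add0r.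
  by apply: ler_sum => i _; rewrite !tuple_consS.
have ih y := coord_lipschitz_integrable (mh y) (Lh y).
pose G y := \int[gauss_tuple R n]_x h y x.
have LG y1 y2 : `|G y1 - G y2| <= L ord0 * `|y1 - y2|.
  rewrite -RintegralB//.
  apply: (le_trans (le_normr_Rintegral _ _)) => //.
    exact: (integrableB measurableT (ih y1) (ih y2)).
  rewrite -[leRHS](Rintegral_const (gauss_tuple R n)).
  apply: le_Rintegral => //.
  - exact: (integrable_norm (integrableB measurableT (ih y1) (ih y2))).
  - exact: integrable_const.
  move=> x _; apply: (le_trans (Lf _ _)).
  rewrite big_ord_recl !tuple_cons0 big1 ?addr0// => i _.
  by rewrite !tuple_consS subrr normr0 mulr0.
rewrite ge0_integral_gauss_tupleS//; last first.
  by apply/measurable_EFinP; exact: measurableT_comp.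
have iG := lipschitz_integrable (L0 ord0) LG.
have ieG := lipschitz_integrable_expR (L0 ord0) LG.
have EG : \int[gauss R]_y G y = \int[gauss_tuple R n.+1]_x f x.
  congr fine; rewrite integral_gauss_tupleS; last exact: coord_lipschitz_integrable Lf.
  by apply: eq_integral => y _; rewrite /G /Rintegral fineK//; exact: integrable_fin_num (ih y).
have mexpG : measurable_fun setT (fun y => (expR (G y))%:E).
  by apply/measurable_EFinP; apply: measurableT_comp => //; exact: lipschitz_measurable LG.
apply: (@le_trans _ _ (\int[gauss R]_y ((expR (\sum_(i < n) L' i ^+ 2))%:E * (expR (G y))%:E))%E).
  apply: ge0_le_integral => //=.
  - by move=> y _; apply: integral_ge0 => x _; rewrite lee_fin expR_ge0.
  - apply: (measurable_fun_fubini_tonelli_F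
      (fun yx : R * n.-tuple R => (expR (f (tuple_cons yx)))%:E)) => //.
    apply/measurable_EFinP; apply: measurableT_comp => //.
    exact: (measurableT_comp mf (@measurable_tuple_cons R n)).
  - exact: measurable_funeM.
  - by move=> y _; rewrite -EFinM -expRD addrC; exact: (IHn L' _ (fun i => L0 _) (mh y) (Lh y)).
rewrite ge0_integralZl//=.
have -> : (\int[gauss R]_y (expR (G y))%:E = (\int[gauss R]_y expR (G y))%:E)%E.
  rewrite /Rintegral fineK//; exact: integrable_fin_num.
rewrite -EFinM lee_fin -EG big_ord_recl /= addrA addrC expRD.
by rewrite ler_wpM2l ?expR_ge0//; apply: gauss_concentration1.
Qed.

End gauss_tuple_theory.

(** * Moments of Gaussian partition functions *)

Section logsumexp.
Variables (R : realType) (n : nat) (I : finType).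
Implicit Types (c : I -> 'I_n -> R) (S : {set I}).

Definition linform (b : 'I_n -> R) (x : n.-tuple R) : R := \sum_(k < n) b k * tnth x k.

Definition sumexp S c x := \sum_(s in S) expR (linform (c s) x).

Lemma linform_integrable b : (gauss_tuple R n).-integrable setT (EFin \o linform b).
Proof.
rewrite (_ : EFin \o _ = fun x => (\sum_(k < n) (b k * tnth x k)%:E)%E); last first.
  by apply/funext => x; rewrite sumEFin.
apply: integrable_sum => // k _; apply: integrable_scale.
exact: gauss_tuple_integrable_tnth.
Qed.

Lemma expR_linform_integrable b :
  (gauss_tuple R n).-integrable setT (EFin \o (expR \o linform b)).
Proof.
apply: integrable_ge0 (gauss_tuple_mgf b) => [|x]; last exact: expR_ge0.
by apply: measurableT_comp => //; exact: measurable_linear.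
Qed.

Lemma Rintegral_expR_linform b :
  \int[gauss_tuple R n]_x expR (linform b x) = expR ((\sum_(k < n) b k ^+ 2) / 2).
Proof. by rewrite /Rintegral gauss_tuple_mgf. Qed.

Lemma linform_scale t b x : linform (fun k => t * b k) x = t * linform b x.
Proof. by rewrite /linform mulr_sumr; apply: eq_bigr => k _; rewrite mulrA. Qed.

Lemma linformD b1 b2 x : linform (fun k => b1 k + b2 k) x = linform b1 x + linform b2 x.
Proof. by rewrite /linform -big_split; apply: eq_bigr => k _; rewrite mulrDl. Qed.

(** From 1 + t m <= exp (t^2 v/2) for all t, where v is the variance: t = s m with
    s small forces m = 0. *)
Lemma Rintegral_linform b : \int[gauss_tuple R n]_x linform b x = 0.
Proof.
set m := \int[_]_x _; pose v := \sum_(k < n) b k ^+ 2.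
have v0 : 0 <= v by apply: sumr_ge0 => k _; exact: sqr_ge0.
have H t : 1 + t * m <= expR (t ^+ 2 * v / 2).
  have <- : \int[gauss_tuple R n]_x (1 + t * linform b x) = 1 + t * m.
    rewrite RintegralD//; last 2 first.
    - exact: integrable_const.
    - by apply: integrable_scale; exact: linform_integrable.
    by rewrite Rintegral_const RintegralZl//; exact: linform_integrable.
  have -> : t ^+ 2 * v = \sum_(k < n) (t * b k) ^+ 2.
    by rewrite /v mulr_sumr; apply: eq_bigr => k _; rewrite exprMn.
  rewrite -Rintegral_expR_linform; apply: le_Rintegral => //.
  - apply: integrable_add; first exact: integrable_const.
    by apply: integrable_scale; exact: linform_integrable.
  - exact: expR_linform_integrable.
  - by move=> x _; rewrite linform_scale; exact: expR_ge1Dx.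
apply/eqP; apply: contraT => m0.
have m2 : 0 < m ^+ 2 by rewrite exprn_even_gt0.
pose s := (1 + v + m ^+ 2)^-1.
have s0 : 0 < s by rewrite invr_gt0; lra.
have sE : s * (1 + v + m ^+ 2) = 1 by rewrite mulVf//; apply/eqP; lra.
have := H (s * m); set u := _ / 2.
have uE : u = s * m ^+ 2 * (s * v / 2) by rewrite /u; ring.
have := expR_ge1Dx (- u); rewrite expRN.
have := expR_gt0 u; set E := expR u => E0 Eu Es.
have EE : E^-1 * E = 1 by rewrite mulVf//; apply/eqP; lra.
have : (1 + s * m ^+ 2) * (1 - u) <= 1.
  have : (1 - u) * E <= 1 by nra.
  have : 1 + s * m ^+ 2 <= E by lra.
  have : 0 < s * m ^+ 2 by rewrite mulr_gt0.
  set q := s * m ^+ 2; nra.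
rewrite uE; have : s * v < 1 by nra.
have : s * m ^+ 2 < 1 by nra.
have : 0 <= s * v by rewrite mulr_ge0// ltW.
have : 0 < s * m ^+ 2 by rewrite mulr_gt0.
set q := s * m ^+ 2; set p := s * v; nra.
Qed.

Lemma sumexp_gt0 S c x : (0 < #|S|)%N -> 0 < sumexp S c x.
Proof.
case/card_gt0P => s sS; rewrite /sumexp (bigD1 s)//= ltr_pwDl ?expR_gt0//.
by apply: sumr_ge0 => *; exact: expR_ge0.
Qed.

Lemma measurable_sumexp S c : measurable_fun setT (sumexp S c).
Proof.
rewrite /sumexp; under eq_fun do rewrite big_mkcond.
apply: measurable_sum => s; case: (s \in S); last exact: measurable_cst.
by apply: measurableT_comp => //; exact: measurable_linear.
Qed.

Lemma measurable_ln_sumexp S c : measurable_fun setT (fun x => ln (sumexp S c x)).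
Proof. by apply: measurableT_comp; [exact: measurable_ln|exact: measurable_sumexp]. Qed.

Lemma ln_sumexp_lipschitz S c (L : R) : (0 < #|S|)%N ->
  (forall s k, `|c s k| <= L) ->
  coord_lipschitz (fun _ => L) (fun x => ln (sumexp S c x)).
Proof.
move=> S0 cL.
have H x y : ln (sumexp S c x) - ln (sumexp S c y) <=
    \sum_(k < n) L * `|tnth x k - tnth y k|.
  set D := \sum_(k < n) _.
  rewrite lerBlDl -[D]expRK -lnM ?posrE ?expR_gt0 ?sumexp_gt0//.
  rewrite ler_ln ?posrE ?mulr_gt0 ?expR_gt0 ?sumexp_gt0//.
  rewrite /sumexp mulr_suml; apply: ler_sum => s _.
  rewrite -expRD ler_expR -lerBlDl /linform -sumrB; apply: ler_sum => k _.
  rewrite -mulrBr (le_trans (ler_norm _))// normrM.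
  by rewrite ler_wpM2r.
move=> x y; rewrite ler_norml H andbT lerNl opprB.
apply: (le_trans (H y x)); apply: ler_sum => k _.
by rewrite distrC.
Qed.

Lemma sumexp_integrable S c : (gauss_tuple R n).-integrable setT (EFin \o sumexp S c).
Proof. by apply: integrable_bigsum => s _; exact: expR_linform_integrable. Qed.

Lemma Rintegral_sumexp S c : \int[gauss_tuple R n]_x sumexp S c x =
  \sum_(s in S) expR ((\sum_(k < n) c s k ^+ 2) / 2).
Proof.
rewrite Rintegral_bigsum; last by move=> s; exact: expR_linform_integrable.
by apply: eq_bigr => s _; exact: Rintegral_expR_linform.
Qed.

Definition sumexp2 S c x :=
  \sum_(s in S) \sum_(t in S) expR (linform (fun k => c s k + c t k) x).

Lemma sumexp2E S c x : sumexp2 S c x = sumexp S c x ^+ 2.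
Proof.
rewrite expr2 /sumexp mulr_suml; apply: eq_bigr => s _.
by rewrite mulr_sumr; apply: eq_bigr => t _; rewrite linformD expRD.
Qed.

Lemma sumexp2_integrable S c : (gauss_tuple R n).-integrable setT (EFin \o sumexp2 S c).
Proof.
by do 2 (apply: integrable_bigsum => ? _); exact: expR_linform_integrable.
Qed.

Lemma Rintegral_sumexp2 S c : \int[gauss_tuple R n]_x sumexp2 S c x =
  \sum_(s in S) \sum_(t in S) expR ((\sum_(k < n) (c s k + c t k) ^+ 2) / 2).
Proof.
rewrite Rintegral_bigsum; last first.
  by move=> s; apply: integrable_bigsum => t _; exact: expR_linform_integrable.
apply: eq_bigr => s _.
rewrite Rintegral_bigsum; last by move=> t; exact: expR_linform_integrable.
by apply: eq_bigr => t _; exact: Rintegral_expR_linform.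
Qed.

Lemma ln_sumexp_integrable S c (L : R) : (0 < #|S|)%N ->
  (forall s k, `|c s k| <= L) ->
  (gauss_tuple R n).-integrable setT (EFin \o (fun x => ln (sumexp S c x))).
Proof.
move=> S0 cL; apply: coord_lipschitz_integrable; last exact: ln_sumexp_lipschitz cL.
exact: measurable_ln_sumexp.
Qed.

Lemma ln_sumexp_shift S c b x : (0 < #|S|)%N ->
  ln (sumexp S (fun s k => c s k + b k) x) = ln (sumexp S c x) + linform b x.
Proof.
move=> S0; rewrite -[X in _ = _ + X]expRK -lnM ?posrE ?sumexp_gt0 ?expR_gt0//.
congr ln; rewrite /sumexp mulr_suml; apply: eq_bigr => s _.
by rewrite linformD expRD.
Qed.

(** Adding one linear form to all energies does not change the mean of the log
    partition function.  This is what allows the centring of the energies. *)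
Lemma Rintegral_ln_sumexp_shift S c b (L : R) : (0 < #|S|)%N ->
  (forall s k, `|c s k| <= L) ->
  \int[gauss_tuple R n]_x ln (sumexp S (fun s k => c s k + b k) x) =
  \int[gauss_tuple R n]_x ln (sumexp S c x).
Proof.
move=> S0 cL; under eq_Rintegral do rewrite ln_sumexp_shift//.
rewrite RintegralD//; last 2 first.
- exact: ln_sumexp_integrable cL.
- exact: linform_integrable.
by rewrite Rintegral_linform addr0.
Qed.

Lemma annealed_bound S c (L : R) : (0 < #|S|)%N -> (forall s k, `|c s k| <= L) ->
  \int[gauss_tuple R n]_x ln (sumexp S c x) <=
  ln (\sum_(s in S) expR ((\sum_(k < n) c s k ^+ 2) / 2)).
Proof.
move=> S0 cL; set f := fun x => ln (sumexp S c x).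
have ef x : expR (f x) = sumexp S c x by rewrite lnK// posrE sumexp_gt0.
rewrite -[leLHS]expRK -Rintegral_sumexp ler_ln ?posrE ?expR_gt0//; last first.
  rewrite Rintegral_sumexp; case/card_gt0P : S0 => s sS.
  rewrite (bigD1 s)//= ltr_pwDl ?expR_gt0//.
  by apply: sumr_ge0 => *; exact: expR_ge0.
have -> : \int[gauss_tuple R n]_x sumexp S c x = \int[gauss_tuple R n]_x expR (f x).
  by apply: eq_Rintegral => x _; rewrite ef.
apply: jensen_expR; first exact: ln_sumexp_integrable cL.
rewrite (_ : expR \o f = sumexp S c); first exact: sumexp_integrable.
by apply/funext => x /=.
Qed.

(** Let y be the ratio of the partition function to its mean a.  Pointwise
    y <= 2 M y^lam + y^2/(2 M), according to whether y <= 2 M.  Integrating,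
    1 <= 2 M E y^lam + 1/2, so E y^lam >= 1/(4 M), while concentration bounds
    E y^lam from above by exp (lam (E ln y) + lam^2 n L^2). *)
Lemma second_moment_bound S c (L M lam : R) : (0 < #|S|)%N ->
  (forall s k, `|c s k| <= L) -> 1 <= M -> 0 < lam <= 1 ->
  \sum_(s in S) \sum_(t in S) expR ((\sum_(k < n) (c s k + c t k) ^+ 2) / 2) <=
    M * (\sum_(s in S) expR ((\sum_(k < n) c s k ^+ 2) / 2)) ^+ 2 ->
  lam * ln (\sum_(s in S) expR ((\sum_(k < n) c s k ^+ 2) / 2)) - ln (4 * M) <=
  lam * \int[gauss_tuple R n]_x ln (sumexp S c x) + lam ^+ 2 * (n%:R * L ^+ 2).
Proof.
move=> S0 cL M1 /andP[lam0 lam1]; rewrite -Rintegral_sumexp -Rintegral_sumexp2.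
set a := \int[_]_x sumexp S c x => aM.
have a0 : 0 < a.
  rewrite /a Rintegral_sumexp; case/card_gt0P : S0 => s sS.
  rewrite (bigD1 s)//= ltr_pwDl ?expR_gt0//.
  by apply: sumr_ge0 => *; exact: expR_ge0.
set f := fun x => ln (sumexp S c x); set m := \int[_]_x f x.
have L0 : (0 < n)%N -> 0 <= L.
  move=> n0; case/card_gt0P : S0 => s _.
  exact: le_trans (normr_ge0 _) (cL s (Ordinal n0)).
have pw x : sumexp S c x / a <=
    2 * M * expR (lam * f x - lam * ln a) + (2 * M * a ^+ 2)^-1 * sumexp2 S c x.
  set z := sumexp S c x; have z0 : 0 < z by exact: sumexp_gt0.
  rewrite -mulrBr; set l := f x - ln a.
  have el : expR l = z / a.
    by rewrite /l expRD expRN !lnK ?posrE.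
  have -> : (2 * M * a ^+ 2)^-1 * sumexp2 S c x = (z / a) ^+ 2 / (2 * M).
    by rewrite sumexp2E -/z; field; rewrite !gt_eqF//=; lra.
  rewrite -el; have [yM|yM] := lerP (expR l) (2 * M).
    have sq : 0 <= expR l ^+ 2 / (2 * M) by rewrite divr_ge0 ?sqr_ge0//; lra.
    suff : expR l <= 2 * M * expR (lam * l) by lra.
    have [l0|l0] := lerP l 0.
      have : expR l <= expR (lam * l) by rewrite ler_expR; nra.
      by have := expR_gt0 (lam * l); nra.
    have : 1 <= expR (lam * l) by rewrite -expR0 ler_expR mulr_ge0 ?ltW.
    nra.
  have : expR l <= expR l ^+ 2 / (2 * M).
    by rewrite ler_pdivlMr ?expr2 ?ler_wpM2l ?expR_ge0 ?(ltW yM)//; lra.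
  have : 0 <= 2 * M * expR (lam * l) by rewrite mulr_ge0 ?expR_ge0//; lra.
  lra.
have flip : coord_lipschitz (fun _ => lam * L) (fun x => lam * f x - lam * ln a).
  move=> x y; rewrite opprB addrA subrK -mulrBr normrM gtr0_norm//.
  apply: (le_trans (ler_wpM2l (ltW lam0) (ln_sumexp_lipschitz S0 cL _ _))).
  by rewrite mulr_sumr; apply: ler_sum => k _; rewrite mulrA.
have mf : measurable_fun setT (fun x => lam * f x - lam * ln a).
  apply: measurable_funB => //; apply: measurable_funM => //.
  exact: measurable_ln_sumexp.
have L0' (k : 'I_n) : 0 <= lam * L.
  by rewrite mulr_ge0 ?(ltW lam0)// L0// (leq_ltn_trans _ (ltn_ord k)).
have fi : (gauss_tuple R n).-integrable setT (EFin \o f) by exact: ln_sumexp_integrable cL.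
have := gauss_tuple_concentration L0' mf flip; clear L0'.
rewrite RintegralB//; [|exact: integrable_scale|exact: integrable_const].
rewrite RintegralZl// Rintegral_const -/m sumr_const card_ord exprMn -(mulr_natl (_ ^+ 2 * _)).
set r := _ + _ => conc.
have eh : (gauss_tuple R n).-integrable setT
    (EFin \o (fun x => expR (lam * f x - lam * ln a))).
  apply/integrableP; split.
    by apply/measurable_EFinP; exact: measurableT_comp.
  under eq_integral do rewrite /= ger0_norm ?expR_ge0//.
  by rewrite (le_lt_trans conc)// ltry.
have er : \int[gauss_tuple R n]_x expR (lam * f x - lam * ln a) <= expR r.
  rewrite -lee_fin (le_trans _ conc)// /Rintegral fineK//.
  exact: integrable_fin_num eh.
have : 1 <= 2 * M * expR r + 2^-1.
  have E1 : \int[gauss_tuple R n]_x (a^-1 * sumexp S c x) = 1.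
    by rewrite RintegralZl//; [rewrite mulVf// gt_eqF|exact: sumexp_integrable].
  rewrite -[X in X <= _]E1.
  apply: (@le_trans _ _ (\int[gauss_tuple R n]_x
     (2 * M * expR (lam * f x - lam * ln a) + (2 * M * a ^+ 2)^-1 * sumexp2 S c x))).
    apply: le_Rintegral => //.
    - by apply: integrable_scale; exact: sumexp_integrable.
    - apply: integrable_add; apply: integrable_scale => //.
      exact: sumexp2_integrable.
    - by move=> x _; rewrite mulrC.
  rewrite RintegralD//; last 2 first.
  - exact: integrable_scale.
  - by apply: integrable_scale; exact: sumexp2_integrable.
  rewrite !RintegralZl//; last exact: sumexp2_integrable.
  apply: lerD; first by apply: ler_wpM2l er; rewrite mulr_ge0// (le_trans ler01 M1).
  rewrite ler_pdivrMl; last by rewrite !mulr_gt0 ?exprn_gt0//; lra.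
  by rewrite (le_trans aM)//; lra.
move=> H.
have : 0 <= ln (4 * M * expR r) by apply: ln_ge0; lra.
rewrite lnM ?posrE ?expR_gt0 ?expRK; [|lra|by []].
by rewrite /r; lra.
Qed.

End logsumexp.

(** * The law of an independent Gaussian family *)

Section iid_law.
Context d (T : measurableType d) (R : realType) (P : probability T R).
Variables (I : finType) (X : I -> {RV P >-> R}).
Hypotheses (Xind : independent_RVs X) (Xnormal : forall i, standard_normal (X i)).

Definition sample (w : T) : #|I|.-tuple R := [tuple X (enum_val k) w | k < #|I|].

Lemma measurable_sample : measurable_fun setT sample.
Proof.
apply/measurable_fun_tnthP => k.
rewrite (_ : _ \o _ = X (enum_val k)); first exact: measurable_funP.
by apply/funext => w /=; rewrite tnth_mktuple.
Qed.

HB.instance Definition _ := isMeasurableFun.Build _ _ _ _ sample measurable_sample.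

Lemma sample_law A : measurable A -> distribution P sample A = gauss_tuple R #|I| A.
Proof.
apply: gauss_tuple_unique => B mB.
transitivity (P (\bigcap_(i in [set` [set: I]%SET]) X i @^-1` B (enum_rank i))).
  congr (P _); apply/seteqP; split => [w wB i _|w wB k] /=.
    by have := wB (enum_rank i); rewrite tnth_mktuple enum_rankK.
  rewrite tnth_mktuple; have := wB (enum_val k).
  by rewrite enum_valK; apply; rewrite /= finset.in_setT.
rewrite Xind//.
rewrite (reindex (@enum_val I predT)) /=; last first.
  by apply: onW_bij; exact: enum_val_bij.
apply: eq_big => [k|k _]; first by rewrite finset.in_setT.
by rewrite enum_valK; exact: Xnormal (mB k).
Qed.

Lemma expectation_sample (f : #|I|.-tuple R -> R) :
  measurable_fun setT f ->
  (gauss_tuple R #|I|).-integrable setT (EFin \o f) ->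
  ('E_P[f \o sample] = (\int[gauss_tuple R #|I|]_x f x)%:E)%E.
Proof.
move=> mf fi.
have law (h : #|I|.-tuple R -> \bar R) :
    (\int[distribution P sample]_x h x = \int[gauss_tuple R #|I|]_x h x)%E.
  by apply: eq_measure_integral => A mA _; exact: sample_law.
rewrite unlock /Rintegral fineK; last exact: integrable_fin_num fi.
rewrite -law integral_distribution//; first exact/measurable_EFinP.
apply/integrableP; split; first by apply/measurable_EFinP; exact: measurableT_comp.
move/integrableP : fi => [_]; rewrite -law ge0_integral_distribution//.
by apply: measurableT_comp => //; exact/measurable_EFinP.
Qed.

End iid_law.

(** * The Potts model as a Gaussian partition function *)

Section potts_gauss.
Variables (R : realType) (N k : nat) (N0 : (0 < N)%N) (k3 : (3 <= k)%N).
Variables (beta : R) (beta0 : 0 <= beta).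
Let K : R := k%:R.
Let C : R := K * potts_const K.
Let N' : R := N%:R.
Let I : finType := ('I_N * 'I_N)%type.

Let K2 : 2 < K. Proof. by rewrite /K (ltr_nat R 2). Qed.
Let K0 : 0 < K. Proof. exact: lt_trans K2. Qed.
Let N'0 : 0 < N'. Proof. by rewrite /N' ltr0n. Qed.

Definition potts_coef (s : {ffun 'I_N -> 'I_k}) (i : 'I_#|I|) : R :=
  beta / Num.sqrt N' * centered R s (enum_val i).1 (enum_val i).2.

Definition mean_log_sum (S : {set {ffun 'I_N -> 'I_k}}) : R :=
  \int[gauss_tuple R #|I|]_x ln (sumexp S potts_coef x).

Lemma sum_pairs (F : I -> R) :
  \sum_(i < #|I|) F (enum_val i) = \sum_(a < N) \sum_(b < N) F (a, b).
Proof.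
rewrite pair_bigA/= (reindex (@enum_val I predT))/=; last first.
  by apply: onW_bij; exact: enum_val_bij.
by apply: eq_bigr => i _; rewrite -surjective_pairing.
Qed.

Lemma potts_coef_cov s t :
  \sum_i potts_coef s i * potts_coef t i = beta ^+ 2 / N' * overlap R [set: 'I_N] s t.
Proof.
rewrite (sum_pairs (fun p => beta / Num.sqrt N' * centered R s p.1 p.2 *
  (beta / Num.sqrt N' * centered R t p.1 p.2))).
rewrite /overlap mulr_sumr; apply: eq_big => [i|i _]; first by rewrite finset.in_setT.
rewrite mulr_sumr; apply: eq_big => [j|j _]; first by rewrite finset.in_setT.
rewrite /= -[X in _ = _ / X * _](sqr_sqrtr (ltW N'0)).
have s0 : 0 < Num.sqrt N' by rewrite sqrtr_gt0.
by field; rewrite gt_eqF.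
Qed.

Lemma potts_coef_le s i : `|potts_coef s i| <= beta / Num.sqrt N'.
Proof.
have b0 : 0 <= beta / Num.sqrt N' by rewrite divr_ge0.
rewrite normrM (ger0_norm b0) ler_piMr// centered_norm//.
exact: leq_trans k3.
Qed.

Lemma card_pairs_coef : #|I|%:R * (beta / Num.sqrt N') ^+ 2 = N' * beta ^+ 2.
Proof.
rewrite card_prod card_ord natrM -/N' exprMn exprVn sqr_sqrtr ?ltW//.
by field; rewrite gt_eqF.
Qed.

Lemma mean_log_sum_mono (S S' : {set {ffun 'I_N -> 'I_k}}) : (0 < #|S|)%N -> S \subset S' ->
  mean_log_sum S <= mean_log_sum S'.
Proof.
move=> S0 SS'; have S'0 : (0 < #|S'|)%N := leq_trans S0 (subset_leq_card SS').
apply: le_Rintegral => //.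
- exact: ln_sumexp_integrable potts_coef_le.
- exact: ln_sumexp_integrable potts_coef_le.
move=> x _; rewrite ler_ln ?posrE ?sumexp_gt0//.
rewrite /sumexp [leRHS](big_setID S)/= (finset.setIidPr SS') lerDl.
by apply: sumr_ge0 => s _; exact: expR_ge0.
Qed.

Let limit := ln K + beta ^+ 2 * (K - 1) / (2 * K ^+ 2).

(** The annealed bound, with [sum_expR_overlap_diag] for the first moment; the
    logarithm comes from the polynomial number of types. *)
Lemma mean_log_sum_upper (S : {set {ffun 'I_N -> 'I_k}}) :
  (0 < #|S|)%N -> beta ^+ 2 * (1 - 2 / K) <= 2 * C ->
  mean_log_sum S <= N' * limit + K * ln (N' + 1).
Proof.
move=> S0 bC; apply: (le_trans (mean_log_sum_mono S0 (finset.subsetT S))).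
have T0 : (0 < #|[set: {ffun 'I_N -> 'I_k}]%SET|)%N.
  exact: leq_trans S0 (subset_leq_card (finset.subsetT S)).
apply: (le_trans (annealed_bound T0 potts_coef_le)).
have H := sum_expR_overlap_diag N0 k3 bC.
rewrite -[leRHS]expRK ler_ln ?posrE ?expR_gt0//; last first.
  case/card_gt0P : T0 => s sT; rewrite (bigD1 s)//= ltr_pwDl ?expR_gt0//.
  by apply: sumr_ge0 => *; exact: expR_ge0.
have -> : expR (N' * limit + K * ln (N' + 1)) =
    expR (beta ^+ 2 * N' * (K - 1) / (2 * K ^+ 2)) * (N.+1 ^ k * k ^ N)%:R.
  rewrite natrM !natrX -/K -(natr1 N) -/N'.
  rewrite (_ : (N' + 1) ^+ k = expR (K * ln (N' + 1))); last first.
    by rewrite mulrC expRM_natr lnK// posrE ltr_wpDr.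
  rewrite (_ : K ^+ N = expR (N' * ln K)); last first.
    by rewrite mulrC expRM_natr lnK// posrE.
  rewrite -!expRD; congr expR; rewrite /limit.
  by field; rewrite gt_eqF.
apply: le_trans H; rewrite le_eqVlt; apply/orP; left; apply/eqP.
apply: eq_big => [s|s _]; first by rewrite finset.in_setT.
under eq_bigr do rewrite expr2.
rewrite potts_coef_cov; congr expR; rewrite -/N'.
by field; rewrite gt_eqF.
Qed.

Variable m : nat.
Hypothesis m0 : (0 < m)%N.
Variable J : {set 'I_N}.
Hypothesis Jm : #|J| = (k * m)%N.
Hypothesis mN : (N < k * m + k)%N.
Let S := type_class J (fun _ : 'I_k => m).
Let M' : R := m%:R.

(** Fewer than k sites lie outside J, hence at most 2 k N pairs. *)
Lemma overlap_block (s t : {ffun 'I_N -> 'I_k}) :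
  `|overlap R [set: 'I_N] s t - overlap R J s t| <= 2 * K * N'.
Proof.
apply: (le_trans (overlap_restrict _ _ _ _ _)); first exact: leq_trans k3.
rewrite Jm natrM -/K -/M' -/N'.
have le1 : K * M' <= N' by rewrite -natrM ler_nat -Jm -[leqRHS]card_ord max_card.
have le2 : N' <= K * M' + K by rewrite -natrM -natrD ler_nat ltnW.
have M'0 : 0 <= M' by [].
set q := K * M' in le1 le2 *; have q0 : 0 <= q by rewrite mulr_ge0// ltW.
have : (N' - q) * (N' + q) <= K * (2 * N').
  by apply: ler_pM; lra.
lra.
Qed.

Let card_S : K ^+ N <= #|S|%:R * (K * M') ^+ k.
Proof.
rewrite exprMn -!natrX -!natrM ler_nat.
exact: card_type_class_ge.
Qed.

Let S0 : (0 < #|S|)%N. Proof. exact: card_type_class_gt0. Qed.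

Let V := beta ^+ 2 * (M' ^+ 2 * (K - 1)) / N'.
Let a := \sum_(s in S) expR ((\sum_i potts_coef s i ^+ 2) / 2).

Lemma first_moment_ge : #|S|%:R * expR (V / 2 - K * beta ^+ 2) <= a.
Proof.
rewrite mulr_natl -sumr_const; apply: ler_sum => s sS; rewrite ler_expR.
under eq_bigr do rewrite expr2.
rewrite potts_coef_cov.
have := overlap_block s s; rewrite (overlap_type_class_diag R k3 Jm sS) -/K -/M'.
rewrite ler_norml => /andP[H _].
have -> : V / 2 - K * beta ^+ 2 =
    beta ^+ 2 / N' * (M' ^+ 2 * (K - 1) - 2 * K * N') / 2.
  by rewrite /V; field; rewrite gt_eqF.
rewrite ler_wpM2r ?invr_ge0// ler_wpM2l//; first by rewrite divr_ge0 ?sqr_ge0// ltW.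
lra.
Qed.

Lemma second_moment_le : beta ^+ 2 <= K * C ->
  \sum_(s in S) \sum_(t in S) expR ((\sum_i (potts_coef s i + potts_coef t i) ^+ 2) / 2)
  <= expR (V + 4 * K * beta ^+ 2) * (N.+1 ^ (k * k) * (k * k) ^ N)%:R.
Proof.
move=> bC; have H := sum_expR_overlap N0 k3 m0 Jm bC.
apply: (le_trans _ (ler_wpM2l (expR_ge0 _) H)).
rewrite mulr_sumr; apply: ler_sum => s sS; rewrite mulr_sumr; apply: ler_sum => t tS.
rewrite -expRD ler_expR.
have -> : \sum_i (potts_coef s i + potts_coef t i) ^+ 2 =
  \sum_i potts_coef s i * potts_coef s i + \sum_i potts_coef t i * potts_coef t i
  + 2 * \sum_i potts_coef s i * potts_coef t i.
  rewrite mulr_sumr -!big_split; apply: eq_bigr => i _ /=; ring.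
rewrite !potts_coef_cov.
have := overlap_block s s; rewrite (overlap_type_class_diag R k3 Jm sS) -/K -/M'.
have := overlap_block t t; rewrite (overlap_type_class_diag R k3 Jm tS) -/K -/M'.
have := overlap_block s t; rewrite -/N'.
rewrite !ler_norml => /andP[_ H1] /andP[_ H2] /andP[_ H3].
have -> : V + 4 * K * beta ^+ 2 + beta ^+ 2 / N' * overlap R J s t =
   beta ^+ 2 / N' * (M' ^+ 2 * (K - 1) + 4 * K * N' + overlap R J s t).
  by rewrite /V; field; rewrite gt_eqF.
have -> : forall x y z, (beta ^+ 2 / N' * x + beta ^+ 2 / N' * y + 2 * (beta ^+ 2 / N' * z)) / 2
   = beta ^+ 2 / N' * ((x + y) / 2 + z) by move=> x y z; field; rewrite gt_eqF.
rewrite ler_wpM2l//; first by rewrite divr_ge0 ?sqr_ge0// ltW.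
lra.
Qed.

(** All corrections to N times the limit are collected in the last term: the
    constant 3 bounds ln 4, the O(beta^2) terms come from the sites outside J,
    and the logarithm from the polynomial factors. *)
Lemma mean_log_sum_lower (lam : R) : 0 < lam <= 1 -> beta ^+ 2 <= K * C ->
  lam * (N' * limit) <= lam * mean_log_sum S + lam ^+ 2 * (N' * beta ^+ 2)
    + (3 + 8 * K * beta ^+ 2 + (K ^+ 2 + 3 * K) * ln (N' + 1)).
Proof.
move=> /andP[lam0 lam1] bC.
set Lg := ln (N' + 1).
have Lg0 : 0 <= Lg by rewrite ln_ge0// lerDr ltW.
have KM1 : 1 <= K * M' by rewrite -natrM ler1n muln_gt0 m0 andbT (leq_trans _ k3).
have KMN : K * M' <= N' by rewrite -natrM ler_nat -Jm -[leqRHS]card_ord max_card.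
have NKM : N' <= K * M' + K by rewrite -natrM -natrD ler_nat ltnW.
have KM0 : 0 < K * M' by exact: lt_le_trans KM1.
have S0' : 0 < #|S|%:R :> R by rewrite ltr0n.
have lnKM : 0 <= ln (K * M') <= Lg.
  rewrite ln_ge0//= ler_ln ?posrE//; last by rewrite ltr_wpDr.
  by rewrite (le_trans KMN)// lerDl.
have lnS : N' * ln K <= ln #|S|%:R + K * Lg.
  have : ln (K ^+ N) <= ln (#|S|%:R * (K * M') ^+ k).
    by rewrite ler_ln ?posrE ?mulr_gt0 ?exprn_gt0.
  rewrite lnM ?posrE ?exprn_gt0// !lnXn// -(mulr_natl (ln K)) -(mulr_natl (ln (K * M'))).
  rewrite -/N' -/K; case/andP: lnKM => _ H1 H2.
  have : K * ln (K * M') <= K * Lg by rewrite ler_wpM2l// ltW.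
  lra.
have a0 : 0 < a.
  by apply: lt_le_trans first_moment_ge; rewrite mulr_gt0 ?expR_gt0.
have lna : ln #|S|%:R + (V / 2 - K * beta ^+ 2) <= ln a.
  rewrite -[V / 2 - _]expRK -lnM ?posrE ?expR_gt0// ler_ln ?posrE ?mulr_gt0 ?expR_gt0//.
  exact: first_moment_ge.
have VN : N' * (beta ^+ 2 * (K - 1) / (2 * K ^+ 2)) <= V / 2 + K * beta ^+ 2.
  have -> : N' * (beta ^+ 2 * (K - 1) / (2 * K ^+ 2)) =
      beta ^+ 2 * ((K - 1) * N' ^+ 2) / (2 * K ^+ 2 * N') by field; rewrite !gt_eqF.
  have -> : V / 2 + K * beta ^+ 2 =
      beta ^+ 2 * ((K - 1) * (K * M') ^+ 2 + 2 * K ^+ 3 * N') / (2 * K ^+ 2 * N').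
    by rewrite /V; field; rewrite !gt_eqF.
  rewrite ler_wpM2r//.
    by rewrite invr_ge0 mulr_ge0 ?mulr_ge0 ?exprn_ge0// ltW.
  rewrite ler_wpM2l ?sqr_ge0//.
  have : N' ^+ 2 <= (K * M') ^+ 2 + 2 * K * N' by nra.
  have K1 : 0 <= K - 1 by rewrite subr_ge0 (le_trans _ (ltW K2))// ler1n.
  move=> /(ler_wpM2l K1).
  have : 2 * K * N' * (K - 1) <= 2 * K * N' * K ^+ 2.
    rewrite ler_wpM2l ?mulr_ge0 ?(ltW K0) ?(ltW N'0)//.
    by have := K2; move: K => x x2; nra.
  lra.
(* In the second moment ratio the sites outside J give exp (4 k beta^2) above and
   exp (- 2 k beta^2) below. *)
pose M := expR (6 * K * beta ^+ 2) * ((N' + 1) ^+ (k * k) * (K * M') ^+ (2 * k)).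
have e1 : 1 <= expR (6 * K * beta ^+ 2).
  by rewrite -expR0 ler_expR !mulr_ge0 ?sqr_ge0// ltW.
have M1 : 1 <= M.
  by rewrite /M mulr_ege1// mulr_ege1// exprn_ege1// lerDr ltW.
have lnM4 : ln (4 * M) <= 3 + 6 * K * beta ^+ 2 + (K ^+ 2 + 2 * K) * Lg.
  have N1 : 0 < N' + 1 by rewrite ltr_wpDr.
  rewrite /M !lnM ?posrE ?mulr_gt0 ?exprn_gt0 ?expR_gt0// expRK !lnXn//.
  rewrite -(mulr_natl (ln (N' + 1))) -(mulr_natl (ln (K * M'))) !natrM -/K -/Lg.
  have l4 : ln 4 <= 3 :> R.
    by have := @le_ln1Dx R 3; rewrite (_ : 1 + 3 = 4 :> R); [apply; rewrite (lt_trans (ltrN10 R))|ring].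
  case/andP: lnKM => _ H1.
  have : 2 * K * ln (K * M') <= 2 * K * Lg by rewrite ler_wpM2l// mulr_ge0// ltW.
  lra.
have aM : \sum_(s in S) \sum_(t in S) expR ((\sum_i (potts_coef s i + potts_coef t i) ^+ 2) / 2)
    <= M * a ^+ 2.
  apply: (le_trans (second_moment_le bC)).
  have f0 : 0 <= #|S|%:R * expR (V / 2 - K * beta ^+ 2) by rewrite mulr_ge0 ?expR_ge0.
  have : (#|S|%:R * expR (V / 2 - K * beta ^+ 2)) ^+ 2 <= a ^+ 2.
    by rewrite ler_sqr ?nnegrE ?(ltW a0)// first_moment_ge.
  have M0 : 0 <= M by exact: le_trans M1.
  move=> /(ler_wpM2l M0); apply: le_trans.
  have kS : (K ^+ N) ^+ 2 <= (#|S|%:R * (K * M') ^+ k) ^+ 2.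
    by rewrite ler_sqr ?nnegrE ?exprn_ge0 ?mulr_ge0 ?exprn_ge0// ltW.
  rewrite natrM !natrX natrM -/K -(natr1 N) -/N' -expr2 exprAC /M.
  have -> : expR (6 * K * beta ^+ 2) * ((N' + 1) ^+ (k * k) * (K * M') ^+ (2 * k)) *
     (#|S|%:R * expR (V / 2 - K * beta ^+ 2)) ^+ 2 =
     expR (V + 4 * K * beta ^+ 2) * ((N' + 1) ^+ (k * k) * (#|S|%:R * (K * M') ^+ k) ^+ 2).
    have -> : V + 4 * K * beta ^+ 2 = 6 * K * beta ^+ 2 + 2 * (V / 2 - K * beta ^+ 2).
      by field.
    move: (V / 2 - K * beta ^+ 2) => w.
    rewrite [(2 * k)%N]mulnC (exprM (K * M')) expRD expRM_natl.
    by move: ((N' + 1) ^+ (k * k)) ((K * M') ^+ k) => A B; ring.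
  by rewrite ler_wpM2l ?expR_ge0// ler_wpM2l// exprn_ge0// addr_ge0// ltW.
have := second_moment_bound S0 potts_coef_le M1 (introT andP (conj lam0 lam1)) aM.
rewrite -/a card_pairs_coef -/(mean_log_sum S) => H.
have H1 : lam * (N' * limit) <= lam * (ln a + (K * Lg + 2 * K * beta ^+ 2)).
  by rewrite ler_wpM2l ?(ltW lam0)// /limit; lra.
have H2 : lam * (K * Lg + 2 * K * beta ^+ 2) <= 1 * (K * Lg + 2 * K * beta ^+ 2).
  rewrite ler_wpM2r// addr_ge0 ?mulr_ge0 ?sqr_ge0// ltW//.
lra.
Qed.

End potts_gauss.

(** * Convergence of the free energies *)

Section free_energy_representation.
Context d (T : measurableType d) (R : realType) (P : probability T R).
Variables (N k : nat) (k3 : (3 <= k)%N) (beta : R) (beta0 : 0 <= beta).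
Variable g : 'I_N -> 'I_N -> {RV P >-> R}.
Hypothesis g_iid : iid_standard_normal g.

Lemma free_energy_onE (S : {set {ffun 'I_N -> 'I_k}}) : (0 < #|S|)%N ->
  free_energy_on S g beta = (N%:R^-1 * mean_log_sum beta S)%:E.
Proof.
move=> S0; rewrite /free_energy_on EFinM; congr (_ * _)%E.
pose I : finType := ('I_N * 'I_N)%type.
pose X (p : I) := g p.1 p.2.
pose b : R := beta / Num.sqrt N%:R / k%:R.
pose c (s : {ffun 'I_N -> 'I_k}) (i : 'I_#|I|) := potts_coef beta s i + b.
have cle s i : `|c s i| <= beta / Num.sqrt N%:R + `|b|.
  by rewrite (le_trans (ler_normD _ _))// lerD2r potts_coef_le.
rewrite (_ : (fun w => _) = (fun x => ln (sumexp S c x)) \o sample X); last first.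
  apply/funext => w /=; congr ln; apply: eq_bigr => s _; congr expR.
  rewrite /linform.
  under [RHS]eq_bigr do rewrite tnth_mktuple.
  rewrite (sum_pairs (fun p : I => (beta / Num.sqrt N%:R * centered R s p.1 p.2 + b) * X p w)).
  rewrite /potts_hamiltonian !mulr_sumr; apply: eq_bigr => i _.
  rewrite !mulr_sumr; apply: eq_bigr => j _ /=.
  by rewrite /b /centered /X /=; ring.
rewrite (expectation_sample (X := X)).
- by rewrite (Rintegral_ln_sumexp_shift _ S0 (potts_coef_le k3 beta0)).
- by case: g_iid.
- by move=> p; case: g_iid => _; apply.
- exact: measurable_ln_sumexp.
- exact: ln_sumexp_integrable cle.
Qed.

End free_energy_representation.

Section rates.
Variable R : realType.

(** The rate N^(-1/4) is also the exponent lam of [mean_log_sum_lower]: it tends to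
    0, and ln N/(lam N) is O(lam). *)
Definition rate (N : nat) : R := (Num.sqrt (Num.sqrt N%:R))^-1.

Lemma rate_cvg : rate @ \oo --> (0 : R).
Proof.
have s0 : Num.sqrt (x : R) @[x --> 0] --> (0 : R).
  by rewrite -[X in _ --> X]sqrtr0; exact: sqrt_continuous.
have h : (fun n => (n.+1%:R : R)^-1) @ \oo --> (0 : R) by exact: cvg_harmonic.
rewrite -(cvg_shiftS rate).
rewrite (_ : (fun n => rate n.+1) =
  Num.sqrt \o (Num.sqrt \o (fun n => (n.+1%:R : R)^-1))); last first.
  by apply/funext => n /=; rewrite !sqrtrV// sqrtr_ge0.
exact: (cvg_comp _ _ (cvg_comp _ _ h s0) s0).
Qed.

Lemma rate_le (m N : nat) : (0 < m)%N -> (m <= N)%N -> rate N <= rate m.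
Proof.
move=> m0 mN; rewrite /rate lef_pV2 ?posrE ?sqrtr_gt0 ?ltr0n ?(leq_trans m0)//.
by rewrite ler_wsqrtr// ler_wsqrtr// ler_nat.
Qed.

Lemma rate_gt0 (N : nat) : (0 < N)%N -> 0 < rate N <= 1.
Proof.
move=> N0; rewrite /rate invr_gt0 !sqrtr_gt0 ltr0n N0/=.
have := @rate_le 1 N isT N0; rewrite /rate sqrtr1 sqrtr1 invr1//.
Qed.

(** From ln y <= y - 1 at y = sqrt (N + 1). *)
Lemma ln_le_rate (N : nat) : (0 < N)%N -> (1 + ln (N%:R + 1)) / N%:R <= 4 * rate N ^+ 2.
Proof.
move=> N0; rewrite /rate exprVn sqr_sqrtr ?sqrtr_ge0//.
have : 1 <= N%:R :> R by rewrite ler1n.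
move: N%:R => x x1.
have x0 : 0 < x by exact: lt_le_trans x1.
have s0 : 0 < Num.sqrt x by rewrite sqrtr_gt0.
have sx : Num.sqrt x ^+ 2 = x by rewrite sqr_sqrtr// ltW.
have t0 : 0 < Num.sqrt (x + 1) by rewrite sqrtr_gt0; lra.
have tx : Num.sqrt (x + 1) ^+ 2 = x + 1 by rewrite sqr_sqrtr//; lra.
have lt : ln (Num.sqrt (x + 1)) <= Num.sqrt (x + 1) - 1.
  have := @le_ln1Dx R (Num.sqrt (x + 1) - 1).
  by rewrite (_ : 1 + (Num.sqrt (x + 1) - 1) = Num.sqrt (x + 1)); [apply; lra|ring].
have l2 : ln (x + 1) = 2 * ln (Num.sqrt (x + 1)).
  by rewrite -{1}tx lnXn// mulr_natl.
have ts : Num.sqrt (x + 1) <= 2 * Num.sqrt x.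
  rewrite -(ler_sqr (ltW t0)) ?nnegrE ?mulr_ge0 ?(ltW s0)// exprMn tx sx; lra.
rewrite ler_pdivrMr//.
have -> : 4 / Num.sqrt x * x = 4 * Num.sqrt x.
  by rewrite -{2}sx; field; rewrite gt_eqF.
by rewrite l2; lra.
Qed.

Variables (k : nat) (k3 : (3 <= k)%N) (beta : R) (beta0 : 0 <= beta).
Let K : R := k%:R.
Let C : R := K * potts_const K.
Let limit := ln K + beta ^+ 2 * (K - 1) / (2 * K ^+ 2).
Let D : R := beta ^+ 2 + 4 * (3 + 8 * K * beta ^+ 2 + (K ^+ 2 + 3 * K)).

Lemma mean_log_sum_rate_upper N (S : {set {ffun 'I_N -> 'I_k}}) :
  (0 < N)%N -> (0 < #|S|)%N -> beta ^+ 2 * (1 - 2 / K) <= 2 * C ->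
  N%:R^-1 * mean_log_sum beta S <= limit + D * rate N.
Proof.
move=> N0 S0 bC.
have := mean_log_sum_upper N0 k3 beta0 S0 bC; rewrite -/K -/limit.
have := ln_le_rate N0; have /andP[q0 q1] := rate_gt0 N0.
have K0 : 0 <= K by [].
have n0 : 0 < N%:R :> R by rewrite ltr0n.
have b2 := sqr_ge0 beta.
move: q0 q1 n0; rewrite /D; move: (mean_log_sum _ _) (rate N) => F q q0 q1.
move: N%:R => n n0; rewrite [_^-1 * _]mulrC !ler_pdivrMr//.
set Lg := ln (n + 1); move=> H1 H2; apply: (le_trans H2).
rewrite mulrDl [limit * _]mulrC lerD2l.
have K1 : K * (1 + Lg) <= K * (4 * q ^+ 2 * n) by rewrite ler_wpM2l.
have qq : q ^+ 2 <= q by rewrite expr2 ler_piMl// ltW.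
have K2 : 4 * K * n * q ^+ 2 <= 4 * K * n * q.
  by rewrite ler_wpM2l// !mulr_ge0// ltW.
have K3 : 4 * K * n * q <= (beta ^+ 2 + 4 * (3 + 8 * K * beta ^+ 2 + (K ^+ 2 + 3 * K))) * (q * n).
  have -> : 4 * K * n * q = 4 * K * (q * n) by ring.
  rewrite ler_wpM2r ?mulr_ge0 ?(ltW q0) ?(ltW n0)//.
  have : 0 <= K * beta ^+ 2 by rewrite mulr_ge0.
  have := sqr_ge0 K; lra.
lra.
Qed.

Lemma mean_log_sum_rate_lower N m (J : {set 'I_N}) :
  (0 < m)%N -> #|J| = (k * m)%N -> (N < k * m + k)%N -> beta ^+ 2 <= K * C ->
  limit - D * rate N <= N%:R^-1 * mean_log_sum beta (type_class J (fun _ : 'I_k => m)).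
Proof.
move=> m0 Jm mN bC.
have N0 : (0 < N)%N.
  have := max_card (mem J); rewrite Jm card_ord; apply: leq_trans.
  by rewrite muln_gt0 m0 andbT (leq_trans _ k3).
have := mean_log_sum_lower N0 k3 beta0 m0 Jm mN (rate_gt0 N0) bC.
rewrite -/K -/limit.
have := ln_le_rate N0; have /andP[q0 q1] := rate_gt0 N0.
have K0 : 0 <= K by [].
have n0 : 0 < N%:R :> R by rewrite ltr0n.
have b2 := sqr_ge0 beta.
have Lg0 : 0 <= ln (N%:R + 1) :> R by rewrite ln_ge0// lerDr ltW.
move: q0 q1 n0 Lg0; rewrite /D; move: (mean_log_sum _ _) (rate N) => F q q0 q1.
move: N%:R => n n0; rewrite [_^-1 * _]mulrC ler_pdivrMr// ler_pdivlMr//.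
set Lg := ln (n + 1); set A := 3 + 8 * K * beta ^+ 2 + (K ^+ 2 + 3 * K); move=> Lg0 H1 H2.
have KK : 0 <= K * beta ^+ 2 by rewrite mulr_ge0.
have K2 := sqr_ge0 K.
have A0 : 0 <= A by rewrite /A; lra.
have HA : 3 + 8 * K * beta ^+ 2 + (K ^+ 2 + 3 * K) * Lg <= A * (4 * q ^+ 2 * n).
  apply: (@le_trans _ _ (A * (1 + Lg))); last by rewrite ler_wpM2l.
  rewrite /A.
  have : 0 <= (3 + 8 * K * beta ^+ 2) * Lg by rewrite mulr_ge0//; lra.
  lra.
rewrite -(ler_pM2l q0).
apply: (@le_trans _ _ (q * (limit * n) - q ^+ 2 * (n * beta ^+ 2) - A * (4 * q ^+ 2 * n))).
  rewrite le_eqVlt; apply/orP; left; apply/eqP; ring.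
lra.
Qed.

End rates.

(** The two terms of the minimum are the conditions of the lower and of the upper
    bound. *)
Lemma beta_threshold_sqr (R : realType) (k : nat) (beta : R) : (3 <= k)%N ->
  0 <= beta -> beta < beta_threshold R k ->
  beta ^+ 2 <= k%:R * (k%:R * potts_const k%:R) /\
  beta ^+ 2 * (1 - 2 / k%:R) <= 2 * (k%:R * potts_const k%:R).
Proof.
move=> k3 b0 bb; have : 2 < k%:R :> R by rewrite (ltr_nat R 2).
move: bb; rewrite /beta_threshold; move: (k%:R : R) => K; set A := K * _ * _ => bb K2.
have l0 : 0 <= ln (K - 1) by apply: ln_ge0; lra.
have A0 : 0 <= A by rewrite /A !mulr_ge0//; lra.
have KC : K * potts_const K = A / K / (K - 2).
  by rewrite /potts_const /A; field; nonzero.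
have s2 : 0 < Num.sqrt (K - 2) by rewrite sqrtr_gt0 subr_gt0.
have sq (x : R) : 0 <= x -> Num.min (1 / Num.sqrt (K - 2)) (Num.sqrt 2 / (K - 2)) <= x ->
    beta ^+ 2 <= A * x ^+ 2.
  move=> x0 mx; have bx : beta <= Num.sqrt A * x.
    by rewrite (le_trans (ltW bb))// ler_wpM2l ?sqrtr_ge0.
  rewrite -[A](sqr_sqrtr A0) -exprMn ler_sqr ?nnegrE//.
  by rewrite mulr_ge0// sqrtr_ge0.
rewrite KC; split.
  have := @sq (1 / Num.sqrt (K - 2)).
  rewrite ge_min lexx/= divr_ge0 ?(ltW s2)// => /(_ isT isT).
  rewrite exprMn exprVn sqr_sqrtr ?expr1n ?mul1r; last by lra.
  have -> : K * (A / K / (K - 2)) = A / (K - 2) by field; nonzero.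
  by [].
have := @sq (Num.sqrt 2 / (K - 2)).
rewrite ge_min lexx orbT divr_ge0 ?sqrtr_ge0//; last by lra.
move=> /(_ isT isT); rewrite exprMn sqr_sqrtr// => H.
have K20 : 0 <= 1 - 2 / K by rewrite subr_ge0 ler_pdivrMr; lra.
apply: (le_trans (ler_wpM2r K20 H)); rewrite le_eqVlt; apply/orP; left; apply/eqP.
by field; nonzero.
Qed.

Lemma balancedE (k m : nat) : (0 < k)%N ->
  balanced k (k * m) = type_class [set: 'I_(k * m)]%SET (fun _ : 'I_k => m).
Proof.
move=> k0; apply/finset.setP => s; rewrite !inE; apply: eq_forallb => a.
rewrite mulKn//; congr (_ == m); by apply: eq_card => i; rewrite !inE.
Qed.

Lemma cvg_of_rate (R : realType) (u : nat -> \bar R) (l D : R) (N1 : nat) :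
  (forall N, (N1 <= N)%N ->
    exists2 x : R, u N = x%:E & l - D * rate R N <= x <= l + D * rate R N) ->
  u @ \oo --> l%:E.
Proof.
move=> H; apply: cvg_EFin.
  near=> N; have [|x -> _] := H N; last by [].
  by near: N; exact: nbhs_infty_ge.
have rD : (fun N => D * rate R N) @ \oo --> (0 : R).
  rewrite -(mulr0 D); apply: cvgM; first exact: cvg_cst.
  exact: rate_cvg.
apply: (@squeeze_cvgr _ _ _ _ (fun N => l - D * rate R N) (fun N => l + D * rate R N)).
- near=> N; have [|x /= -> //] := H N.
  by near: N; exact: nbhs_infty_ge.
- by rewrite -[X in _ --> X]subr0; apply: cvgB rD; exact: cvg_cst.
- by rewrite -[X in _ --> X]addr0; apply: cvgD rD; exact: cvg_cst.
Unshelve. all: by end_near. Qed.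

Theorem theorem1p3 (R : realType) (d : measure_display) (T : measurableType d)
    (P : probability T R) (kappa : nat)
    (g : forall N : nat, 'I_N -> 'I_N -> {RV P >-> R})
    (kappa_ge3 : (3 <= kappa)%N)
    (g_iid : forall N : nat, iid_standard_normal (g N))
    (beta : R) (beta_ge0 : 0 <= beta) (beta_lt : beta < beta_threshold R kappa) :
  let l : R :=
    ln kappa%:R + beta ^+ 2 * (kappa%:R - 1) / (2 * kappa%:R ^+ 2) in
  [/\ (fun m : nat => balanced_free_energy kappa (g (kappa * m)%N) beta) @ \oo
        --> l%:E,
      (fun N : nat => free_energy kappa (g N) beta) @ \oo --> l%:E
    & preserves_color_symmetry kappa g beta].
Proof.
move=> l.
have k0 : (0 < kappa)%N by exact: leq_trans kappa_ge3.
have [blow bup] := beta_threshold_sqr kappa_ge3 beta_ge0 beta_lt.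
set K : R := kappa%:R in blow bup.
pose D : R := beta ^+ 2 + 4 * (3 + 8 * K * beta ^+ 2 + (K ^+ 2 + 3 * K)).
have D0 : 0 <= D by rewrite /D !addr_ge0// ?mulr_ge0 ?addr_ge0 ?mulr_ge0 ?sqr_ge0.
have bal : (fun m : nat => balanced_free_energy kappa (g (kappa * m)%N) beta) @ \oo --> l%:E.
  apply: (@cvg_of_rate _ _ _ D 1) => m m0.
  have N0 : (0 < kappa * m)%N by rewrite muln_gt0 k0.
  have cJ : #|[set: 'I_(kappa * m)]%SET| = (kappa * m)%N by rewrite cardsT card_ord.
  rewrite /balanced_free_energy balancedE//; set S := type_class _ _.
  have S0 : (0 < #|S|)%N by exact: card_type_class_gt0 cJ.
  exists ((kappa * m)%:R^-1 * mean_log_sum beta S).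
    exact: (free_energy_onE kappa_ge3 beta_ge0 (g_iid _)).
  have rm : D * rate R (kappa * m) <= D * rate R m.
    by rewrite ler_wpM2l// rate_le// leq_pmull.
  have Nk : (kappa * m < kappa * m + kappa)%N by rewrite -[ltnLHS]addn0 ltn_add2l.
  have up := mean_log_sum_rate_upper kappa_ge3 beta_ge0 N0 S0 bup.
  have lo := mean_log_sum_rate_lower kappa_ge3 beta_ge0 m0 cJ Nk blow.
  by rewrite (le_trans _ lo) ?(le_trans up)// ?lerD2l ?lerN2.
have full : (fun N : nat => free_energy kappa (g N) beta) @ \oo --> l%:E.
  apply: (@cvg_of_rate _ _ _ D kappa) => N kN.
  have N0 : (0 < N)%N by exact: leq_trans kN.
  pose m := (N %/ kappa)%N; have m0 : (0 < m)%N by rewrite divn_gt0.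
  have kmN : (kappa * m <= N)%N by rewrite mulnC leq_divM.
  have Nkm : (N < kappa * m + kappa)%N by rewrite addnC -mulnS mulnC ltn_ceil.
  (* Balance the first kappa m sites, and leave the others free. *)
  pose J : {set 'I_N} := [set widen_ord kmN i | i : 'I_(kappa * m)]%SET.
  have cJ : #|J| = (kappa * m)%N.
    by rewrite card_imset ?card_ord// => i j /(congr1 val) /= /val_inj.
  set F := free_energy _ _ _; pose S := type_class J (fun _ : 'I_kappa => m).
  have S0 : (0 < #|S|)%N by exact: card_type_class_gt0 cJ.
  have T0 : (0 < #|[set: {ffun 'I_N -> 'I_kappa}]%SET|)%N.
    exact: leq_trans S0 (subset_leq_card (finset.subsetT S)).
  exists (N%:R^-1 * mean_log_sum beta [set: {ffun 'I_N -> 'I_kappa}]%SET).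
    exact: (free_energy_onE kappa_ge3 beta_ge0 (g_iid _)).
  rewrite (mean_log_sum_rate_upper kappa_ge3 beta_ge0 N0 T0 bup) andbT.
  apply: (le_trans (mean_log_sum_rate_lower kappa_ge3 beta_ge0 m0 cJ Nkm blow)).
  rewrite ler_wpM2l//.
  exact: mean_log_sum_mono S0 (finset.subsetT S).
split => //; split.
- by apply/cvg_ex; exists l%:E.
- by apply/cvg_ex; exists l%:E.
- by rewrite (cvg_lim _ bal)// (cvg_lim _ full).
Qed.
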